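(* Let $d,a,b,n\in\mathbb{N}^+$, let $\{\ ,\ \}$ be a regular Poisson bracket on $\mathbb{R}^d$, and let $(\mathbb{R}[(\mathbb{R}^d)^n][[\hbar]],\star)^{S_n}$ be the algebra of quantum symmetric functions on $(\mathbb{R}^d)^n$ with the Kontsevich $\star$-product. Let $p=(p_1,\dots,p_a)\in\mathbb{R}[y_1,\dots,y_d]^a$ and $q=(q_1,\dots,q_b)\in\mathbb{R}[y_1,\dots,y_d]^b$, and let $\alpha\in\mathbb{N}^a$, $\beta\in\mathbb{N}^b$ satisfy $|\alpha|\le n$ and $|\beta|\le n$. Then $$e_\alpha(p)\star e_\beta(q)=\sum_{m=0}^\infty\Big(\sum_{\gamma\in \mathrm{K}(\alpha,\beta,n,m)}e_\gamma(B(p,q))\Big)\hbar^m ,$$ where: (i) $B(p,q)=(p,q,\dots,\frac{\omega_\Gamma}{\overline{\Gamma}!}B_\Gamma(p,q),\dots)$ is the family consisting of $p_1,\dots,p_a$, of $q_1,\dots,q_b$, and, for every $\Gamma\in\mathbb{G}$, of $\frac{\omega_\Gamma}{\overline{\Gamma}!}B_\Gamma(p,q)$, where $B_\Gamma(p,q)=(B_\Gamma(p_1,q_1),\dots,B_\Gamma(p_1,q_b),\dots,B_\Gamma(p_a,q_1),\dots,B_\Gamma(p_a,q_b))$ and $B_\Gamma(p_i,q_j)$ is the result of applying Kontsevich's bi-differential operator $B_\Gamma$ (on $\mathbb{R}^d$) to $(p_i,q_j)$. In $e_\gamma(B(p,q))$ the index $\gamma_{l0\emptyset}$ corresponds to $p_l$,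 the index $\gamma_{0r\emptyset}$ to $q_r$ (with $\emptyset$ the graph with no edges), and the index $\gamma_{lr\Gamma}$ (with $l\in[a]$, $r\in[b]$, $\Gamma\in\mathbb{G}$) to $\frac{\omega_\Gamma}{\overline{\Gamma}!}B_\Gamma(p_l,q_r)$. (ii) $\mathrm{K}(\alpha,\beta,n,m)$ is the set of maps $\gamma:[0,a]\times[0,b]\times\mathbb{G}\to\mathbb{N}$, $(l,r,\Gamma)\mapsto\gamma_{lr\Gamma}$, such that: $\gamma_{00\Gamma}=0$ for all $\Gamma$; if $l=0$ or $r=0$ then $\gamma_{lr\Gamma}=0$ for $\overline{\Gamma}\ge1$; $|\gamma|=\sum_{l=0}^a\sum_{r=0}^b\sum_{\Gamma\in\mathbb{G}}\gamma_{lr\Gamma}\le n$; $\sum_{l=0}^a\sum_{r=0}^b\sum_{\Gamma\in\mathbb{G}}\overline{\Gamma}\,\gamma_{lr\Gamma}=m$; $\sum_{r=0}^b\sum_{\Gamma\in\mathbb{G}}\gamma_{lr\Gamma}=\alpha_l$ for $l\in[a]$; and $\sum_{l=0}^a\sum_{\Gamma\in\mathbb{G}}\gamma_{lr\Gamma}=\beta_r$ for $r\in[b]$.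
   Context: Notation: $\mathbb{N}=\{0,1,2,\dots\}$, $[n]=\{1,\dots,n\}$, $[0,a]=\{0,1,\dots,a\}$, $|\alpha|=\sum_i\alpha_i$. Multi-symmetric functions. Points of $(\mathbb{R}^d)^n$ have coordinates $x_{ij}$, $i\in[n]$, $j\in[d]$, and $S_n$ acts by permuting the index $i$. For $f\in\mathbb{R}[y_1,\dots,y_d]$ and $i\in[n]$ put $f(i)=f(x_{i1},\dots,x_{id})$. For a finite or countable family $u=(u_s)_{s\in S}$ of polynomials in $\mathbb{R}[y_1,\dots,y_d]$ and a finitely supported $\delta:S\to\mathbb{N}$ with $|\delta|=\sum_s\delta_s\le n$, the polynomial $e_\delta(u)\in\mathbb{R}[(\mathbb{R}^d)^n]^{S_n}$ is defined by $\prod_{i=1}^n\big(1+\sum_{s\in S}u_s(i)t_s\big)=\sum_{|\delta|\le n}e_\delta(u)t^\delta$, with commuting formal variables $t_s$ and $t^\delta=\prod_s t_s^{\delta_s}$. Poisson structures. A Poisson bracket on $\mathbb{R}^N$ is a bilinear antisymmetric bracket on $C^\infty(\mathbb{R}^N)$ satisfying the Leibniz and Jacobi identities; with coordinates $z_1,\dots,z_N$ it is regular if all $\pi_{ij}=\{z_i,z_j\}$ are polynomials. A regular Poisson bracket on $\mathbb{R}^d$ (coordinates $y_1,\dots,y_d$, $\pi_{ij}=\{y_i,y_j\}$) induces the product Poisson bracket on $(\mathbb{R}^d)^n$: $\{x_{ki},x_{lj}\}=\delta_{kl}\,\pi_{ij}(k)$. Kontsevich star product. For $k\ge0$ let $\mathbb{G}_k$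 be the set of directed graphs with vertices $1,\dots,k,L,R$ and $2k$ edges such that each $v\in[k]$ is the source of exactly two ordered edges $e_v^1,e_v^2$, with distinct targets in $\{1,\dots,k,L,R\}\setminus\{v\}$, and no edges start at $L$ or $R$. Put $\mathbb{G}=\bigsqcup_{k\ge0}\mathbb{G}_k$ and $\overline{\Gamma}=k$ if $\Gamma\in\mathbb{G}_k$; $\mathbb{G}_0=\{\emptyset\}$, where $\emptyset$ has no edges, $\omega_\emptyset=1$ and $B_\emptyset(f,g)=fg$. For a regular Poisson structure $\pi$ on $\mathbb{R}^N$ and $\Gamma\in\mathbb{G}_k$, $$B_\Gamma(f,g)=\sum_{I}\Big[\prod_{v=1}^k\Big(\prod_{e\to v}\partial_{I(e)}\Big)\pi_{I(e_v^1)I(e_v^2)}\Big]\Big(\prod_{e\to L}\partial_{I(e)}f\Big)\Big(\prod_{e\to R}\partial_{I(e)}g\Big),$$ the sum being over all maps $I$ from edges to $[N]$ (all derivatives attached to a vertex act on the single function at that vertex), and $$\omega_\Gamma=\frac{1}{2^k(2\pi)^{2k}}\int\bigwedge_{v=1}^k d\varphi_{e_v^1}\wedge d\varphi_{e_v^2},$$ (here $2\pi$ is the numerical constant) integrated over configurations of $k$ distinct points $z_1,\dots,z_k$ in the open upper half plane with its standard orientation, with $z_L=0$, $z_R=1$, and $\varphi_e=\arg\frac{z_w-z_v}{z_w-\overline{z_v}}$ for an edge $e$ from $v$ to $w$. The Kontsevich star product on $\mathbb{R}[z_1,\dots,z_N][[\hbar]]$ is the $\mathbb{R}[[\hbar]]$-bilinear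 product with $f\star g=\sum_{\Gamma\in\mathbb{G}}\frac{\omega_\Gamma}{\overline{\Gamma}!}B_\Gamma(f,g)\hbar^{\overline{\Gamma}}$ for polynomials $f,g$; it is normalized so that $f\star g=fg+\tfrac12\{f,g\}\hbar+O(\hbar^2)$. The product $\star$ of multi-symmetric functions is the Kontsevich star product on $(\mathbb{R}^d)^n$ with the product Poisson structure. $S_n$ acts on $(\mathbb{R}[(\mathbb{R}^d)^n][[\hbar]],\star)$ by algebra automorphisms, and the algebra of quantum symmetric functions is the subalgebra of invariants. *)

(* Defs.v *)
(* MathComp-Analysis, with [mpoly] from multinomials and [R[i]] from
   real-closed.  The notations of mpoly.v clash with those of
   MathComp-Analysis, hence the import without notations. *)
From HB Require Import structures.
From mathcomp Require Import all_boot all_order all_algebra all_fingroup finmap.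
From mathcomp Require Import all_classical all_reals all_analysis.
From mathcomp Require Import complex.
From mathcomp Require mpoly.
Import -(notations) mpoly.

Set Implicit Arguments.
Unset Strict Implicit.
Unset Printing Implicit Defensive.

Import Order.TTheory GRing.Theory Num.Theory.
Import numFieldNormedType.Exports.
Local Open Scope classical_set_scope.
Local Open Scope ring_scope.

(* ** Regular Poisson brackets *)

(* [C^oo (R^N)]: every iterated partial derivative exists and is continuous. *)
Definition iter_partial (R : realType) (N : nat) (s : seq 'I_N)
    (f : 'rV[R]_N -> R) : 'rV[R]_N -> R :=
  foldr (fun j g => 'D_(delta_mx 0 j) g) f s.

Definition smooth (R : realType) (N : nat) (f : 'rV[R]_N -> R) : Prop :=
  forall s : seq 'I_N,
    continuous (iter_partial s f) /\
    forall (j : 'I_N) (x : 'rV[R]_N),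
      derivable (iter_partial s f) x (delta_mx 0 j).

Definition mpoly_fun (R : realType) (N : nat) (f : mpoly N R) :
    'rV[R]_N -> R :=
  fun x => meval (fun i => x 0 i) f.

(* The bracket is only meaningful on smooth functions; its values elsewhere
   are unconstrained.  The polynomials [poisson_pi i j] representing
   [{z_i, z_j}] are uniquely determined, R being infinite. *)
Record regular_poisson (R : realType) (N : nat) := RegularPoisson {
  bracket : ('rV[R]_N -> R) -> ('rV[R]_N -> R) -> ('rV[R]_N -> R);
  poisson_pi : 'I_N -> 'I_N -> mpoly N R;
  bracket_smooth : forall f g, smooth f -> smooth g -> smooth (bracket f g);
  bracket_linearl : forall (c : R) f g h, smooth f -> smooth g -> smooth h ->
    bracket (c *: f + g) h = c *: bracket f h + bracket g h;
  bracket_linearr : forall (c : R) f g h, smooth f -> smooth g -> smooth h ->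
    bracket f (c *: g + h) = c *: bracket f g + bracket f h;
  bracket_antisym : forall f g, smooth f -> smooth g ->
    bracket f g = - bracket g f;
  bracket_leibniz : forall f g h, smooth f -> smooth g -> smooth h ->
    bracket f (g * h) = bracket f g * h + g * bracket f h;
  bracket_jacobi : forall f g h, smooth f -> smooth g -> smooth h ->
    bracket f (bracket g h) + bracket g (bracket h f)
      + bracket h (bracket f g) = 0;
  poisson_piE : forall i j : 'I_N,
    bracket (mpoly_fun (mpolyX R (mnm1 i))) (mpoly_fun (mpolyX R (mnm1 j)))
    = mpoly_fun (poisson_pi i j)
}.

(* ** Kontsevich graphs and their bidifferential operators *)

(* Vertices of a graph in G_k: [inl v] for v in [k], and L, R. *)
Definition vertex (k : nat) : finType := ('I_k + bool)%type.
Definition vL (k : nat) : vertex k := inr false.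
Definition vR (k : nat) : vertex k := inr true.

(* Edges of a graph in G_k: [(v, false)] is e_v^1 and [(v, true)] is e_v^2. *)
Definition edge (k : nat) : finType := ('I_k * bool)%type.

(* A graph is given by the targets of its edges. *)
Definition is_graph (k : nat) (t : {ffun edge k -> vertex k}) : bool :=
  [forall v : 'I_k, [&& t (v, false) != t (v, true),
    t (v, false) != inl v & t (v, true) != inl v]].

Definition graph (k : nat) : finType :=
  {t : {ffun edge k -> vertex k} | is_graph t}.

Definition target (k : nat) (G : graph k) (e : edge k) : vertex k := val G e.

Definition all_graphs : countType := {k : nat & graph k}.

Definition nvert (G : all_graphs) : nat := tag G.

Definition deriv_at (R : realType) (N k : nat) (G : graph k)
    (I : {ffun edge k -> 'I_N}) (w : vertex k) (h : mpoly N R) : mpoly N R :=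
  foldr (fun e g => mderiv (I e) g) h
    [seq e <- enum (edge k) | target G e == w].

Definition bidiff (R : realType) (N k : nat) (pi : 'I_N -> 'I_N -> mpoly N R)
    (G : graph k) (f g : mpoly N R) : mpoly N R :=
  \sum_(I : {ffun edge k -> 'I_N})
    (\prod_(v < k) deriv_at G I (inl v) (pi (I (v, false)) (I (v, true))))
    * deriv_at G I (vL k) f * deriv_at G I (vR k) g.

(* ** Kontsevich weights *)

(* The n-th power of a measure, on the product sigma-algebra of n-tuples. *)
Fixpoint power_measure d (T : measurableType d) (R : realType)
    (mu : set T -> \bar R) (n : nat) : set (n.-tuple T) -> \bar R :=
  match n with
  | 0 => \d_ [tuple]
  | n'.+1 => fun A =>
      (\int[mu]_x power_measure mu [set t : n'.-tuple T | A (cons_tuple x t)])%E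
  end.

(* A point [x + i y] of the plane is the pair [(x, y)]. *)
Definition plane (R : realType) := (measurableTypeR R * measurableTypeR R)%type.

Definition plane_lebesgue (R : realType) : set (plane R) -> \bar R :=
  (@lebesgue_measure R \x @lebesgue_measure R)%E.

Definition half_plane_conf (R : realType) (k : nat) : set (k.-tuple (plane R)) :=
  [set z | (forall v : 'I_k, 0 < (tnth z v).2 :> R) /\
           (forall v w : 'I_k, v != w -> tnth z v <> tnth z w)].

Definition pos (R : realType) (k : nat) (z : k.-tuple (plane R))
    (w : vertex k) : R[i] :=
  match w with
  | inl v => (((tnth z v).1 : R) +i* ((tnth z v).2 : R))%C
  | inr false => 0
  | inr true => 1
  end.

Definition principal_arg (R : realType) (u : R[i]) : R :=
  xget 0 [set t : R | - pi < t <= pi /\ u = `|u| * (cos t +i* sin t)%C].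

Definition edge_ratio (R : realType) (k : nat) (G : graph k) (e : edge k)
    (z : k.-tuple (plane R)) : R[i] :=
  let zv := pos z (inl e.1) in
  let zw := pos z (target G e) in
  (zw - zv) / (zw - conjc zv).

(* The angle phi_e is only defined modulo 2 pi: this is its determination
   which is continuous near [z0] and principal at [z0]. *)
Definition edge_angle (R : realType) (k : nat) (G : graph k) (e : edge k)
    (z0 z : k.-tuple (plane R)) : R :=
  principal_arg (edge_ratio G e z0)
  + principal_arg (edge_ratio G e z / edge_ratio G e z0).

(* The 2k real coordinates of a configuration are indexed by ['I_k * bool]:
   [(v, false)] is x_v and [(v, true)] is y_v. *)
Definition move (R : realType) (k : nat) (z : k.-tuple (plane R))
    (c : 'I_k * bool) (t : R) : k.-tuple (plane R) :=
  [tuple if v == c.1 then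
           (((tnth z v).1 : R) + (if c.2 then 0 else t),
            ((tnth z v).2 : R) + (if c.2 then t else 0))
         else tnth z v | v < k].

Definition dangle (R : realType) (k : nat) (G : graph k)
    (z : k.-tuple (plane R)) (e : edge k) (c : 'I_k * bool) : R :=
  derive1 (fun t : R => edge_angle G e z (move z c t)) 0.

(* Coefficient of /\_v dphi_{e_v^1} /\ dphi_{e_v^2} with respect to
   /\_v dx_v /\ dy_v.  Edges and coordinates are enumerated in the same order,
   so that the determinant does not depend on the enumeration. *)
Definition angle_form (R : realType) (k : nat) (G : graph k)
    (z : k.-tuple (plane R)) : R :=
  \det (\matrix_(i < #|{: 'I_k * bool}|, j < #|{: 'I_k * bool}|)
          dangle G z (enum_val i) (enum_val j)).

Definition weight (R : realType) (k : nat) (G : graph k) : R :=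
  (2 ^+ k * (2 * pi) ^+ (2 * k))^-1
  * fine (\int[power_measure (@plane_lebesgue R) (n := k)]_(z in
        @half_plane_conf R k) (angle_form G z)%:E)%E.

(* ** Kontsevich star product *)

(* Elements of R[z_1, ..., z_N][[hbar]], as sequences of coefficients. *)
Definition hseries (R : realType) (N : nat) := nat -> mpoly N R.

Definition hconst (R : realType) (N : nat) (f : mpoly N R) : hseries R N :=
  fun m => if m == 0%N then f else 0.

Definition star_coef (R : realType) (N : nat) (pi : 'I_N -> 'I_N -> mpoly N R)
    (k : nat) (f g : mpoly N R) : mpoly N R :=
  \sum_(G : graph k) (weight R G / (k`!)%:R) *: bidiff pi G f g.

Definition star (R : realType) (N : nat) (pi : 'I_N -> 'I_N -> mpoly N R)
    (F H : hseries R N) : hseries R N :=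
  fun m => \sum_(i < m.+1) \sum_(j < m.+1) \sum_(k < m.+1 | (i + j + k)%N == m)
    star_coef pi k (F i) (H j).

(* ** Multi-symmetric functions *)

(* The coordinates x_ij of (R^d)^n are numbered by [enum_rank (i, j)]. *)
Definition ncoord (n d : nat) : nat := #|{: 'I_n * 'I_d}|.

Definition xvar (R : realType) (n d : nat) (i : 'I_n) (j : 'I_d) :
    mpoly (ncoord n d) R :=
  mpolyX R (mnm1 (enum_rank (i, j))).

Definition at_point (R : realType) (n d : nat) (i : 'I_n) (f : mpoly d R) :
    mpoly (ncoord n d) R :=
  comp_mpoly [tuple xvar R i j | j < d] f.

Definition product_pi (R : realType) (n d : nat)
    (pi : 'I_d -> 'I_d -> mpoly d R) (x y : 'I_(ncoord n d)) :
    mpoly (ncoord n d) R :=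
  let: (k, i) := enum_val x in
  let: (l, j) := enum_val y in
  if k == l then at_point k (pi i j) else 0.

Definition perm_points (R : realType) (n d : nat) (s : 'S_n)
    (f : mpoly (ncoord n d) R) : mpoly (ncoord n d) R :=
  comp_mpoly [tuple xvar R (s (enum_val x).1) (enum_val x).2 | x < ncoord n d] f.

Definition quantum_symmetric (R : realType) (n d : nat) :
    set (hseries R (ncoord n d)) :=
  [set F | forall (s : 'S_n) (m : nat), perm_points s (F m) = F m].

(* Finitely supported exponents delta : S -> nat. *)
Notation expo S := {fsfun S -> nat with 0%N}.

Definition expo_var (S : choiceType) (s : S) : expo S :=
  [fsfun x in [fset s]%fset => 1%N | 0%N].

(* Formal power series in commuting variables t_s, s in S, given by the
   coefficients of their monomials t^delta. *)
Definition tseries (A : Type) (S : choiceType) := expo S -> A.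

Definition tone (A : nzRingType) (S : choiceType) : tseries A S :=
  fun delta => if finsupp delta == fset0 then 1 else 0.

(* The index set is finite, so that the finitely supported sum is the genuine
   sum over it; so is [Kset] below. *)
Definition tmul (A : nzRingType) (S : choiceType) (F H : tseries A S) :
    tseries A S :=
  fun delta =>
    \sum_(x \in [set x : expo S * expo S | forall s, x.1 s + x.2 s = delta s]%N)
      F x.1 * H x.2.

(* \sum_s u_s t_s *)
Definition tlinear (A : nzRingType) (S : choiceType) (u : S -> A) :
    tseries A S :=
  fun delta => \sum_(s <- finsupp delta | delta == expo_var s) u s.

Definition multisym (R : realType) (n d : nat) (S : choiceType)
    (u : S -> mpoly d R) (delta : expo S) : mpoly (ncoord n d) R :=
  (\big[@tmul _ S/@tone _ S]_(i < n)
     (fun eps => @tone _ S eps + tlinear (fun s => at_point i (u s)) eps)) delta.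

(* ** The index set and the family of the product formula *)

(* Indices (l, r, G) in [0, a] x [0, b] x G; [lift ord0] embeds
   [a] = {1, ..., a} into [0, a]. *)
Notation gindex a b := ('I_a.+1 * 'I_b.+1 * all_graphs)%type.

(* The family B(p, q), extended by 0 to the indices (0, 0, G), and (l, 0, G),
   (0, r, G) with G nonempty, which index no member of it and at which the
   elements of [Kset] vanish. *)
Definition Bfamily (R : realType) (d a b : nat)
    (pi : 'I_d -> 'I_d -> mpoly d R)
    (p : 'I_a -> mpoly d R) (q : 'I_b -> mpoly d R) (s : gindex a b) :
    mpoly d R :=
  let G := s.2 in
  match unlift ord0 s.1.1, unlift ord0 s.1.2 with
  | Some l, Some r =>
      (weight R (tagged G) / ((nvert G)`!)%:R)
        *: bidiff pi (tagged G) (p l) (q r)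
  | Some l, None => if nvert G == 0%N then p l else 0
  | None, Some r => if nvert G == 0%N then q r else 0
  | None, None => 0
  end.

Definition Kset (a b n m : nat) (alpha : expo 'I_a) (beta : expo 'I_b) :
    set (expo (gindex a b)) :=
  [set gamma : expo (gindex a b) |
    [/\ forall G, gamma (ord0, ord0, G) = 0%N,
        forall l r G, l = ord0 \/ r = ord0 -> (1 <= nvert G)%N ->
          gamma (l, r, G) = 0%N,
        (\sum_(s <- finsupp gamma) gamma s <= n)%N
      & (\sum_(s <- finsupp gamma) nvert s.2 * gamma s)%N = m] /\
    [/\ forall l : 'I_a,
          (\sum_(s <- finsupp gamma | s.1.1 == lift ord0 l) gamma s)%N = alpha l
      & forall r : 'I_b,
          (\sum_(s <- finsupp gamma | s.1.2 == lift ord0 r) gamma s)%N = beta r]].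

(* Main.v *)
Require Import Defs.
From HB Require Import structures.
From mathcomp Require Import all_boot all_order all_algebra all_fingroup finmap.
From mathcomp Require Import all_classical all_reals all_analysis.
From mathcomp Require Import measurable_realfun complex ring lra.
From mathcomp Require mpoly.
Import -(notations) mpoly.

(** Expanding the generating products, e_alpha(p) is the sum, over the colourings
    of the n points in which the colour l is used alpha_l times, of the products
    of the p_l at the points coloured by l. Hence it suffices to show that the
    star product of two products over the points is the product over the points
    of the star products on R^d, and that 1 is a unit for the star product on
    R^d.

    In the star product of products, a labelled graph contributes only if both
    labels at each vertex belong to one point and every edge joins vertices of
    the same point, so the graph splits into pieces, one for each point. The
    weight of a graph is the product of the weights of its pieces: the angle form
    is block diagonal, so the integrand is a product of functions of disjoint
    sets of variables, and Tonelli applies because collisions between pieces form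
    a null set. No convergence is needed: if the integral of one factor is not
    finite, then [fine] sends both sides to 0. A graph on k vertices occurs
    once for each distribution of its vertices, which accounts for the factorials.

    A graph with k > 0 vertices and no edge to R (resp. L) has weight 0, because
    its angles are invariant under the dilations centered at L (resp. R), so the
    generating vector field is in the kernel of all the dphi_e. As B_G(f, 1) = 0
    for the other graphs, 1 is a unit. *)

Set Implicit Arguments.
Unset Strict Implicit.
Unset Printing Implicit Defensive.

Import Order.TTheory GRing.Theory Num.Theory.
Local Open Scope ring_scope.

(** * Splitting the bidifferential operators *)

(** The unit property enters at the points where only one of the two colourings chooses a factor:
    there the star product produces [B_G(p_l, 1)] or [B_G(1, q_r)] with nonempty [G], for which B(p,
    q) has no member and which [Kset] excludes. The weights have no usable closed form, so only
    structural properties of the integral are available. The splitting over points uses just two of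
    them, multiplicativity under gluing and the value 1 on the graph without vertices, and is
    carried out for any function [w] having them. On the analytic side the obstacle is that [dangle]
    is the derivative of a branch of an argument; it is first replaced by a rational function of the
    coordinates, which makes measurability, the zero blocks of the determinant and the kernel vector
    elementary. The vertices of a piece are renumbered by [enum_val], and its positions are cut out
    of the list of all positions by a boolean mask, so that Tonelli becomes an induction on the
    mask. Infinitely many graphs index B(p, q), but at order [m] only those with at most [m]
    vertices occur, which makes all sums finite. *)

Definition derivs (R : realType) (N : nat) (s : seq 'I_N) (f : mpoly N R) :=
  foldr (@mderiv N R) f s.

(** In characteristic 0 this says that [f] is a polynomial in the coordinates of [S]; the
    differential form is the one that makes terms vanish. *)
Definition depends_on (R : realType) (N : nat) (S : {set 'I_N})
    (f : mpoly N R) := forall x, x \notin S -> mderiv x f = 0.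

Lemma derivs0 (R : realType) (N : nat) (s : seq 'I_N) :
  derivs s (0 : mpoly N R) = 0.
Proof. by elim: s => //= x s; rewrite /derivs /= => ->; rewrite mderiv0. Qed.

Lemma derivsD (R : realType) (N : nat) (s : seq 'I_N) (f g : mpoly N R) :
  derivs s (f + g) = derivs s f + derivs s g.
Proof. by elim: s => //= x s; rewrite /derivs /= => ->; rewrite mderivD. Qed.

Lemma depends_on_derivs (R : realType) (N : nat) (S : {set 'I_N})
    (s : seq 'I_N) (f : mpoly N R) :
  depends_on S f -> depends_on S (derivs s f).
Proof.
move=> Sf; elim: s => //= x s IHs y Sy.
by rewrite /derivs /= mderiv_comm -/(derivs s f) IHs // mderiv0.
Qed.

Lemma derivs_eq0 (R : realType) (N : nat) (S : {set 'I_N})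
    (s : seq 'I_N) (f : mpoly N R) :
  depends_on S f -> has [predC S] s -> derivs s f = 0.
Proof.
move=> Sf; elim: s => //= x s IHs; rewrite /derivs /= -/(derivs s f).
case/orP => [xS|/IHs ->]; last exact: mderiv0.
exact: (depends_on_derivs _ Sf).
Qed.

(** In the Leibniz rule each derivative sees one factor only: those along [S2] kill [f1], and those
    along [S1] kill every derivative of [f2]. *)
Lemma derivsM (R : realType) (N : nat) (S1 S2 : {set 'I_N})
    (s1 s2 : seq 'I_N) (f1 f2 : mpoly N R) :
  [disjoint S1 & S2] -> depends_on S1 f1 -> depends_on S2 f2 ->
  all (mem S1) s1 -> all (mem S2) s2 ->
  derivs (s1 ++ s2) (f1 * f2) = derivs s1 f1 * derivs s2 f2.
Proof.
move=> dS Sf1 Sf2 Ss1 Ss2; rewrite /derivs foldr_cat -!/(derivs _ _).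
have -> : derivs s2 (f1 * f2) = f1 * derivs s2 f2.
  elim: s2 Ss2 => //= y s2 IHs /andP[yS2 Ss2].
  rewrite /derivs /= -!/(derivs _ _) IHs // mderivM Sf1 ?mul0r ?add0r //.
  by apply/negP => yS1; move/pred0P/(_ y): dS; rewrite /= yS1 yS2.
elim: s1 Ss1 => //= x s1 IHs /andP[xS1 Ss1].
rewrite /derivs /= -!/(derivs _ _) IHs // mderivM.
rewrite (depends_on_derivs _ Sf2) ?mulr0 ?addr0 //.
by apply/negP => xS2; move/pred0P/(_ x): dS; rewrite /= xS1 xS2.
Qed.

Lemma deriv_atE (R : realType) (N k : nat) (G : graph k)
    (I : {ffun edge k -> 'I_N}) (w : vertex k) (h : mpoly N R) :
  deriv_at G I w h
  = derivs [seq I e | e <- enum (edge k) & target G e == w] h.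
Proof. by rewrite /deriv_at /derivs foldr_map. Qed.

(** * Gluing two graphs along a partition of the vertices *)

Section Glue.
Context (k : nat) (A : {set 'I_k}).

(** Weights and operators exist only for vertices numbered by an ordinal, so a piece on the vertices
    of [B] is a graph on [#|B|] vertices; L and R are common to all pieces. *)
Definition embed_vertex (B : {set 'I_k}) (w : vertex #|B|) : vertex k :=
  match w with inl v => inl (enum_val v) | inr b => inr b end.

Definition embed_edge (B : {set 'I_k}) (e : edge #|B|) : edge k :=
  (enum_val e.1, e.2).

Lemma embed_vertex_inj (B : {set 'I_k}) : injective (@embed_vertex B).
Proof. by move=> [v|b] [v'|b'] //= [] => [/enum_val_inj|] ->. Qed.

Lemma embed_edge_inj (B : {set 'I_k}) : injective (@embed_edge B).
Proof. by move=> [v b] [v' b'] [/enum_val_inj -> ->]. Qed.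

(** Serves both for targets, where [h1] and [h2] renumber vertices, and for labels, where they are
    identities. By [edge_split] the default [x0] is never reached. *)
Definition glue_fun (T T1 T2 : Type) (x0 : T) (h1 : T1 -> T) (h2 : T2 -> T)
    (f1 : edge #|A| -> T1) (f2 : edge #|~: A| -> T2) (e : edge k) : T :=
  if [pick e1 | embed_edge e1 == e] is Some e1 then h1 (f1 e1) else
  if [pick e2 | embed_edge e2 == e] is Some e2 then h2 (f2 e2) else x0.

Lemma glue_funl (T T1 T2 : Type) (x0 : T) (h1 : T1 -> T) (h2 : T2 -> T)
    (f1 : edge #|A| -> T1) (f2 : edge #|~: A| -> T2) e1 :
  glue_fun x0 h1 h2 f1 f2 (embed_edge e1) = h1 (f1 e1).
Proof.
rewrite /glue_fun; case: pickP => [e /eqP/embed_edge_inj -> //|].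
by move/(_ e1); rewrite eqxx.
Qed.

Lemma glue_funr (T T1 T2 : Type) (x0 : T) (h1 : T1 -> T) (h2 : T2 -> T)
    (f1 : edge #|A| -> T1) (f2 : edge #|~: A| -> T2) e2 :
  glue_fun x0 h1 h2 f1 f2 (embed_edge e2) = h2 (f2 e2).
Proof.
rewrite /glue_fun; case: pickP => [e /eqP[eA _]|_].
  have := enum_valP e2.1; rewrite -eA inE => /negP[]; exact: enum_valP.
case: pickP => [e /eqP/embed_edge_inj -> //|].
by move/(_ e2); rewrite eqxx.
Qed.

Lemma edge_split (e : edge k) :
  (exists e1 : edge #|A|, e = embed_edge e1) \/
  (exists e2 : edge #|~: A|, e = embed_edge e2).
Proof.
case: e => v b; have [vA|vA] := boolP (v \in A).
  by left; exists (enum_rank_in vA v, b); rewrite /embed_edge /= enum_rankK_in.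
have vA' : v \in ~: A by rewrite inE.
by right; exists (enum_rank_in vA' v, b); rewrite /embed_edge /= enum_rankK_in.
Qed.

Definition glue_targets (G1 : graph #|A|) (G2 : graph #|~: A|) :
    {ffun edge k -> vertex k} :=
  [ffun e => glue_fun (vL k) (@embed_vertex A) (@embed_vertex (~: A))
               (target G1) (target G2) e].

Lemma graphP (j : nat) (t : {ffun edge j -> vertex j}) :
  reflect (forall v, [/\ t (v, false) != t (v, true)
                      & forall b, t (v, b) != inl v])
          (is_graph t).
Proof.
apply: (iffP forallP) => Gt v.
  by have /and3P[? ? ?] := Gt v; split => // -[].
by have [-> tb] := Gt v; rewrite !tb.
Qed.

Lemma glue_subproof G1 G2 : is_graph (glue_targets G1 G2).
Proof.
apply/graphP => v.
have [[[v1 b1] [-> _]]|[[v2 b2] [-> _]]] := edge_split (v, true).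
- have E b : (enum_val v1, b) = embed_edge (v1, b) by [].
  have /graphP/(_ v1)[G1v G1b] := valP G1.
  split=> [|b]; rewrite !ffunE !E !glue_funl ?(inj_eq (@embed_vertex_inj _)) //.
  by rewrite -[inl (enum_val v1)]/(embed_vertex (inl v1))
    (inj_eq (@embed_vertex_inj _)); apply: G1b.
- have E b : (enum_val v2, b) = embed_edge (v2, b) by [].
  have /graphP/(_ v2)[G2v G2b] := valP G2.
  split=> [|b]; rewrite !ffunE !E !glue_funr ?(inj_eq (@embed_vertex_inj _)) //.
  by rewrite -[inl (enum_val v2)]/(embed_vertex (inl v2))
    (inj_eq (@embed_vertex_inj _)); apply: G2b.
Qed.

Definition glue_graph (G1 : graph #|A|) (G2 : graph #|~: A|) : graph k :=
  Sub (glue_targets G1 G2) (glue_subproof G1 G2).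

Lemma target_gluel G1 G2 e1 :
  target (glue_graph G1 G2) (embed_edge e1) = embed_vertex (target G1 e1).
Proof. by rewrite /target /= ffunE glue_funl. Qed.

Lemma target_gluer G1 G2 e2 :
  target (glue_graph G1 G2) (embed_edge e2) = embed_vertex (target G2 e2).
Proof. by rewrite /target /= ffunE glue_funr. Qed.

Definition glue_labels (T : Type) (x0 : T) (I1 : {ffun edge #|A| -> T})
    (I2 : {ffun edge #|~: A| -> T}) : {ffun edge k -> T} :=
  [ffun e => glue_fun x0 id id I1 I2 e].

Lemma perm_vertices :
  perm_eq (enum 'I_k) ([seq enum_val v | v <- enum 'I_#|A|] ++
                       [seq enum_val v | v <- enum 'I_#|~: A|]).
Proof.
apply: uniq_perm; first exact: enum_uniq.
  rewrite cat_uniq !(map_inj_uniq enum_val_inj) !enum_uniq andbT /=.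
  apply/hasPn => _ /mapP[v _ ->]; apply/negP => /mapP[v' _ E].
  by have := enum_valP v; rewrite E inE enum_valP.
move=> v; rewrite mem_enum mem_cat; apply/esym.
have [[[v1 b1] [-> _]]|[[v2 b2] [-> _]]] := edge_split (v, true).
  by apply/orP; left; rewrite map_f // mem_enum.
by apply/orP; right; rewrite map_f // mem_enum.
Qed.

Lemma perm_edges :
  perm_eq (enum (edge k)) ([seq embed_edge e | e <- enum (edge #|A|)] ++
                           [seq embed_edge e | e <- enum (edge #|~: A|)]).
Proof.
apply: uniq_perm; first exact: enum_uniq.
  rewrite cat_uniq !(map_inj_uniq (@embed_edge_inj _)) !enum_uniq andbT /=.
  apply/hasPn => _ /mapP[e _ ->]; apply/negP => /mapP[e' _ [E _]].
  by have := enum_valP e.1; rewrite E inE enum_valP.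
move=> e; rewrite mem_enum mem_cat; apply/esym.
have [[e1 ->]|[e2 ->]] := edge_split e.
  by apply/orP; left; rewrite map_f // mem_enum.
by apply/orP; right; rewrite map_f // mem_enum.
Qed.

Lemma graph_restrict (G : graph k) (B : {set 'I_k}) :
  (forall (e : edge #|B|) v, target G (embed_edge e) = inl v -> v \in B) ->
  exists G1 : graph #|B|,
    forall e, target G (embed_edge e) = embed_vertex (target G1 e).
Proof.
(* The value [inr false] in the first branch is a mere default: by [GB] the target vertex lies in
   [B]. *)
move=> GB; pose t1 : {ffun edge #|B| -> vertex #|B|} := [ffun e =>
    match target G (embed_edge e) with
    | inl v => if [pick a : 'I_#|B| | enum_val a == v] is Some a then inl a
               else inr false
    | inr b => inr b end].
have t1E e : target G (embed_edge e) = embed_vertex (t1 e).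
  rewrite ffunE; have := GB e; case: (target G _) => [v|b] //= /(_ v erefl) vB.
  case: pickP => [a /eqP <- //|/(_ (enum_rank_in vB v))].
  by rewrite enum_rankK_in // eqxx.
have t1G : is_graph t1.
  apply/graphP => v; have /graphP/(_ (enum_val v))[Gv Gb] := valP G.
  have E b : val G (enum_val v, b) = embed_vertex (t1 (v, b)) by rewrite -t1E.
  split=> [|b]; first by apply: contra_neq Gv; rewrite !E => ->.
  by apply: contra_neq (Gb b); rewrite E => ->.
by exists (Sub t1 t1G) => e; rewrite /target /= -t1E.
Qed.

Lemma glue_graph_onto (G : graph k) :
  (forall e v, target G e = inl v -> (v \in A) = (e.1 \in A)) ->
  exists G1 G2, G = glue_graph G1 G2.
Proof.
move=> GA; have [|G1 G1E] := @graph_restrict G A.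
  by move=> e v /GA ->; apply: enum_valP.
have [|G2 G2E] := @graph_restrict G (~: A).
  by move=> e v /GA; rewrite inE => ->; have := enum_valP e.1; rewrite inE.
exists G1, G2; apply/val_inj/ffunP => e; rewrite -!/(target _ _).
have [[e1 ->]|[e2 ->]] := edge_split e.
  by rewrite target_gluel G1E.
by rewrite target_gluer G2E.
Qed.

Lemma glue_labels_onto (T : Type) (x0 : T) (I : {ffun edge k -> T}) :
  I = glue_labels x0 [ffun e : edge #|A| => I (embed_edge e)]
        [ffun e : edge #|~: A| => I (embed_edge e)].
Proof.
apply/ffunP => e; rewrite ffunE.
have [[e1 ->]|[e2 ->]] := edge_split e; first by rewrite glue_funl ffunE.
by rewrite glue_funr ffunE.
Qed.

End Glue.

Section GlueTerms.
Context (R : realType) (N k : nat) (A : {set 'I_k}).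
Context (G1 : graph #|A|) (G2 : graph #|~: A|) (x0 : 'I_N).
Context (I1 : {ffun edge #|A| -> 'I_N}) (I2 : {ffun edge #|~: A| -> 'I_N}).
Let G := glue_graph G1 G2.
Let I := glue_labels x0 I1 I2.

Lemma glue_labelsl e1 : I (embed_edge e1) = I1 e1.
Proof. by rewrite ffunE glue_funl. Qed.

Lemma glue_labelsr e2 : I (embed_edge e2) = I2 e2.
Proof. by rewrite ffunE glue_funr. Qed.

(** The enumeration of all edges interleaves those of the two pieces, so the list splits only up to
    permutation; this suffices because partial derivatives commute. *)
Lemma perm_labels_at (w : vertex k) :
  perm_eq [seq I e | e <- enum (edge k) & target G e == w]
   ([seq I1 e | e <- enum (edge #|A|) & embed_vertex (target G1 e) == w] ++
    [seq I2 e | e <- enum (edge #|~: A|) & embed_vertex (target G2 e) == w]).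
Proof.
have := perm_map I (perm_filter [pred e | target G e == w] (perm_edges A)).
rewrite filter_cat map_cat !filter_map -!map_comp.
rewrite (eq_map glue_labelsl) (eq_map glue_labelsr).
rewrite -(@eq_filter _ [pred e | embed_vertex (target G1 e) == w]); last first.
  by move=> e /=; rewrite target_gluel.
rewrite -(@eq_filter _ [pred e | embed_vertex (target G2 e) == w]) //.
by move=> e /=; rewrite target_gluer.
Qed.

Lemma deriv_at_gluel (v : 'I_#|A|) (f : mpoly N R) :
  deriv_at G I (inl (enum_val v)) f = deriv_at G1 I1 (inl v) f.
Proof.
rewrite !deriv_atE /derivs (mderiv_perm _ (perm_labels_at _)).
rewrite (@eq_filter _ _ [pred e | target G1 e == inl v]); last first.
  by move=> e /=; rewrite -[inl (enum_val v)]/(embed_vertex (inl v))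
    (inj_eq (@embed_vertex_inj _ _)).
rewrite (@eq_filter _ (fun e => embed_vertex (target G2 e) == _) pred0) ?filter_pred0
  ?cats0 // => e /=.
apply/negP => /eqP; case: (target G2 e) => //= v2 [E].
by have := enum_valP v2; rewrite E inE enum_valP.
Qed.

Lemma deriv_at_gluer (v : 'I_#|~: A|) (f : mpoly N R) :
  deriv_at G I (inl (enum_val v)) f = deriv_at G2 I2 (inl v) f.
Proof.
rewrite !deriv_atE /derivs (mderiv_perm _ (perm_labels_at _)).
rewrite (@eq_filter _ (fun e => embed_vertex (target G1 e) == _) pred0);
  last first.
  move=> e /=; apply/negP => /eqP; case: (target G1 e) => //= v1 [E].
  by have := enum_valP v1; have := enum_valP v; rewrite E inE => /negP.
rewrite filter_pred0 (@eq_filter _ _ [pred e | target G2 e == inl v]) // => e.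
by rewrite /= -[inl (enum_val v)]/(embed_vertex (inl v))
    (inj_eq (@embed_vertex_inj _ _)).
Qed.

(** L and R are the only vertices that receive edges from both pieces; there the disjointness of the
    variables separates the derivatives. *)
Lemma deriv_at_glueM (S1 S2 : {set 'I_N}) (b : bool) (f1 f2 : mpoly N R) :
  [disjoint S1 & S2] -> depends_on S1 f1 -> depends_on S2 f2 ->
  (forall e, I1 e \in S1) -> (forall e, I2 e \in S2) ->
  deriv_at G I (inr b) (f1 * f2)
  = deriv_at G1 I1 (inr b) f1 * deriv_at G2 I2 (inr b) f2.
Proof.
move=> dS Sf1 Sf2 SI1 SI2.
rewrite !deriv_atE {1}/derivs (mderiv_perm _ (perm_labels_at _)) -/(derivs _ _).
rewrite (@derivsM _ _ S1 S2) //.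
- congr (derivs _ _ * derivs _ _); congr map; apply: eq_filter => e;
  exact: (inj_eq (@embed_vertex_inj _ _) _ (inr b)).
- by apply/allP => _ /mapP[e _ ->]; apply: SI1.
- by apply/allP => _ /mapP[e _ ->]; apply: SI2.
Qed.

End GlueTerms.

Definition bidiff_term (R : realType) (N k : nat)
    (pi : 'I_N -> 'I_N -> mpoly N R) (G : graph k)
    (I : {ffun edge k -> 'I_N}) (f g : mpoly N R) : mpoly N R :=
  (\prod_(v < k) deriv_at G I (inl v) (pi (I (v, false)) (I (v, true))))
    * deriv_at G I (vL k) f * deriv_at G I (vR k) g.

Definition labels_in (N k : nat) (S : {set 'I_N}) (I : {ffun edge k -> 'I_N})
    : bool := [forall e, I e \in S].

(* [k!] times the k-th coefficient of the star product, keeping only the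
   derivatives along the coordinates in [S]. *)
Definition partial_star (R : realType) (N : nat) (w : forall k, graph k -> R)
    (pi : 'I_N -> 'I_N -> mpoly N R) (S : {set 'I_N}) (k : nat)
    (f g : mpoly N R) : mpoly N R :=
  \sum_(D : graph k * {ffun edge k -> 'I_N} | labels_in S D.2)
    w k D.1 *: bidiff_term pi D.1 D.2 f g.

Definition glue_multiplicative (R : realType) (w : forall k, graph k -> R) :=
  forall (k : nat) (A : {set 'I_k}) (G1 : graph #|A|) (G2 : graph #|~: A|),
    w k (glue_graph G1 G2) = w _ G1 * w _ G2.

Definition block_structure (R : realType) (N : nat)
    (pi : 'I_N -> 'I_N -> mpoly N R) (S1 S2 : {set 'I_N}) :=
  [/\ forall x y, x \in S1 -> y \in S2 -> pi x y = 0 /\ pi y x = 0,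
      forall x y, x \in S1 -> y \in S1 -> depends_on S1 (pi x y)
    & forall x y, x \in S2 -> y \in S2 -> depends_on S2 (pi x y)].

(** * Separation over two disjoint blocks of coordinates *)

Section Split.
Context (R : realType) (N : nat) (w : forall k, graph k -> R).
Context (pi : 'I_N -> 'I_N -> mpoly N R) (S1 S2 : {set 'I_N}).
Hypothesis (wM : glue_multiplicative w).
Hypothesis (dS : [disjoint S1 & S2]).
Hypothesis (piS : block_structure pi S1 S2).
Context (f1 f2 g1 g2 : mpoly N R).
Hypothesis (Sf1 : depends_on S1 f1) (Sf2 : depends_on S2 f2).
Hypothesis (Sg1 : depends_on S1 g1) (Sg2 : depends_on S2 g2).

Let notS2 x : x \in S1 -> x \notin S2.
Proof. by move=> x1; apply/negP => x2; move/pred0P/(_ x): dS; rewrite /= x1 x2. Qed.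

Lemma bidiff_term_glue k (A : {set 'I_k}) (G1 : graph #|A|) (G2 : graph #|~: A|)
    x0 I1 I2 : labels_in S1 I1 -> labels_in S2 I2 ->
  bidiff_term pi (glue_graph G1 G2) (glue_labels x0 I1 I2) (f1 * f2) (g1 * g2)
  = bidiff_term pi G1 I1 f1 g1 * bidiff_term pi G2 I2 f2 g2.
Proof.
move=> /forallP SI1 /forallP SI2; rewrite /bidiff_term.
rewrite !(deriv_at_glueM _ _ _ _ dS) //.
have -> (P : 'I_k -> mpoly N R) : \prod_(v < k) P v
    = \prod_(v < #|A|) P (enum_val v) * \prod_(v < #|~: A|) P (enum_val v).
  have E j (Q : 'I_j -> mpoly N R) : \prod_v Q v = \prod_(v <- enum 'I_j) Q v.
    by rewrite big_enum; apply: eq_bigl.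
  by rewrite !E (perm_big _ (perm_vertices A)) big_cat !big_map.
rewrite [X in X * _ * _ * _](_ : _ = \prod_(v < #|A|)
    deriv_at G1 I1 (inl v) (pi (I1 (v, false)) (I1 (v, true)))); last first.
  apply: eq_bigr => v _; rewrite deriv_at_gluel.
  by rewrite -!(glue_labelsl x0 I1 I2).
rewrite [X in _ * X * _ * _](_ : _ = \prod_(v < #|~: A|)
    deriv_at G2 I2 (inl v) (pi (I2 (v, false)) (I2 (v, true)))); last first.
  apply: eq_bigr => v _; rewrite deriv_at_gluer.
  by rewrite -!(glue_labelsr x0 I1 I2).
have ACA (a b c d e f : mpoly N R) :
  a * b * (c * d) * (e * f) = a * c * e * (b * d * f).
  by rewrite (mulrACA a b c d) (mulrACA (a * c) (b * d)).
exact: ACA.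
Qed.

Lemma deriv_at_outside k (G : graph k) (I : {ffun edge k -> 'I_N})
    (S : {set 'I_N}) (e : edge k) (f : mpoly N R) :
  depends_on S f -> I e \notin S -> deriv_at G I (target G e) f = 0.
Proof.
move=> Sf SIe; rewrite deriv_atE; apply: (derivs_eq0 Sf).
apply/hasP; exists (I e) => //; apply: map_f.
by rewrite mem_filter eqxx mem_enum.
Qed.

(** The block of a vertex is read off its first label. A vertex with labels in both blocks carries a
    mixed component of [pi], which is 0; an edge between blocks differentiates a component of [pi]
    along a coordinate on which it does not depend. *)
Lemma bidiff_term_neq0 k (G : graph k) (I : {ffun edge k -> 'I_N}) f g :
  labels_in (S1 :|: S2) I -> bidiff_term pi G I f g != 0 ->
  let A := [set v | I (v, false) \in S1] in
  (forall e, (I e \in S1) = (e.1 \in A)) /\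
  (forall e v, target G e = inl v -> (v \in A) = (e.1 \in A)).
Proof.
move=> /forallP SI nz A; have [p12 p1 p2] := piS.
have {SI}S12 e : I e \in S2 = (I e \notin S1).
  have := SI e; rewrite inE; case: (boolP (I e \in S1)) => [/notS2/negbTE->//|].
  by [].
have {nz}nz v : deriv_at G I (inl v) (pi (I (v, false)) (I (v, true))) != 0.
  apply: contra_neq nz => v0; rewrite /bidiff_term (bigD1 v) //= v0.
  by rewrite !mul0r.
have IA v : (I (v, true) \in S1) = (I (v, false) \in S1).
  apply/idP/idP => vS; apply/negPn/negP; rewrite -S12 => vS';
    have := nz v; first by rewrite (p12 _ _ vS vS').2 deriv_atE derivs0 eqxx.
  by rewrite (p12 _ _ vS vS').1 deriv_atE derivs0 eqxx.
have IAe e : (I e \in S1) = (e.1 \in A) by case: e => v []; rewrite inE // IA.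
split=> // e v ev; apply/idP/idP; rewrite -IAe inE => vS; last first.
  apply/negPn/negP; rewrite -S12 => vS2.
  have vS2' : I (v, true) \in S2 by rewrite S12 IA -S12.
  have := nz v; rewrite -ev (@deriv_at_outside _ _ _ S2) ?eqxx //; last exact: notS2.
  exact: p2.
apply/negPn/negP => eS.
have := nz v; rewrite -ev (@deriv_at_outside _ _ _ S1) ?eqxx //.
by apply: p1 => //; rewrite IA.
Qed.

Lemma partial_starM k (x0 : 'I_N) :
  partial_star w pi (S1 :|: S2) k (f1 * f2) (g1 * g2)
  = \sum_(A : {set 'I_k})
      partial_star w pi S1 #|A| f1 g1 * partial_star w pi S2 #|~: A| f2 g2.
Proof.
rewrite /partial_star.
pose colour (D : graph k * {ffun edge k -> 'I_N}) :=
  [set v | D.2 (v, false) \in S1].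
rewrite (partition_big colour xpredT) //=; apply: eq_bigr => A _.
pose gl (x : (graph #|A| * {ffun edge #|A| -> 'I_N}) *
              (graph #|~: A| * {ffun edge #|~: A| -> 'I_N})) :=
  (glue_graph x.1.1 x.2.1, glue_labels x0 x.1.2 x.2.2).
pose X : {set ((graph #|A| * {ffun edge #|A| -> 'I_N}) *
               (graph #|~: A| * {ffun edge #|~: A| -> 'I_N}))} :=
  [set x | labels_in S1 x.1.2 && labels_in S2 x.2.2].
have gl_inj : {in X &, injective gl}.
  move=> [[G1 I1] [G2 I2]] [[G1' I1'] [G2' I2']] _ _ E.
  have /= EG := congr1 fst E; have {E} /= EI := congr1 snd E.
  congr ((_, _), (_, _)).
  - apply/val_inj/ffunP => e; apply: (@embed_vertex_inj _ A).
    by rewrite -!/(target _ _) -(target_gluel G1 G2) -(target_gluel G1' G2') EG.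
  - apply/ffunP => e; rewrite -(glue_labelsl x0 I1 I2).
    by move/ffunP/(_ (embed_edge e)): EI; rewrite /= !glue_labelsl => <-.
  - apply/val_inj/ffunP => e; apply: (@embed_vertex_inj _ (~: A)).
    by rewrite -!/(target _ _) -(target_gluer G1 G2) -(target_gluer G1' G2') EG.
  - apply/ffunP => e; rewrite -(glue_labelsr x0 I1 I2).
    by move/ffunP/(_ (embed_edge e)): EI; rewrite /= !glue_labelsr => <-.
(* The labelled graphs of colour [A] include some that are not glued from two pieces; by
   [bidiff_term_neq0] their terms are 0. *)
transitivity (\sum_(D in gl @: X) w D.1 *: bidiff_term pi D.1 D.2 (f1 * f2) (g1 * g2)).
  rewrite [LHS]big_mkcond [RHS]big_mkcond; apply: eq_bigr => D _.
  case: ifPn => [/andP[SD /eqP DA]|nD].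
    case: ifPn => // nX; apply/eqP; apply: contraNT nX => nz.
    have {}nz : bidiff_term pi D.1 D.2 (f1 * f2) (g1 * g2) != 0.
      by apply: contra_neq nz => ->; rewrite scaler0.
    have := bidiff_term_neq0 SD nz; rewrite /= -/(colour D) DA => -[IA].
    move=> /glue_graph_onto[G1 [G2 GE]].
    apply/imsetP; exists ((G1, [ffun e => D.2 (embed_edge e)]),
                          (G2, [ffun e => D.2 (embed_edge e)])); last first.
      by rewrite /gl /= -GE -glue_labels_onto -surjective_pairing.
    rewrite inE /=; apply/andP; split; apply/forallP => e; rewrite ffunE.
      by rewrite IA enum_valP.
    have := forallP SD (embed_edge e); rewrite inE IA /=.
    by have := enum_valP e.1; rewrite inE => /negbTE ->.
  case: ifP => // /imsetP[[[G1 I1] [G2 I2]]]; rewrite inE /= => /andP[SI1 SI2] DE.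
  case/negP: nD; rewrite DE /=; apply/andP; split.
    apply/forallP => e; rewrite inE.
    have [[e1 ->]|[e2 ->]] := edge_split A e.
      by rewrite glue_labelsl (forallP SI1).
    by rewrite glue_labelsr (forallP SI2) orbT.
  apply/eqP/setP => v; rewrite inE /gl /=.
  have [[[v1 b1] [-> _]]|[[v2 b2] [-> _]]] := edge_split A (v, true).
    rewrite -[(_, _)]/(embed_edge (v1, false)) glue_labelsl (forallP SI1).
    by rewrite enum_valP.
  rewrite -[(_, _)]/(embed_edge (v2, false)) glue_labelsr.
  have := enum_valP v2; rewrite inE => /negbTE ->; apply/negP => /notS2.
  by rewrite (forallP SI2).
rewrite big_imset //= big_distrlr pair_big /=; apply: eq_big => [x|x].
  by rewrite inE.
rewrite inE => /andP[SI1 SI2]; rewrite wM bidiff_term_glue //.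
by rewrite -scalerAl -scalerAr scalerA.
Qed.

End Split.

Lemma mpoly_generators_ind (R : realType) (N : nat) (Q : mpoly N R -> Prop) :
  (forall c, Q (mpolyC N c)) -> (forall i, Q (mpolyX R (mnm1 i))) ->
  (forall f g, Q f -> Q g -> Q (f + g)) ->
  (forall f g, Q f -> Q g -> Q (f * g)) -> forall f, Q f.
Proof.
move=> QC QX QD QM; elim/mpolyind => [|c m f _ _ Qf]; first by rewrite -mpolyC0.
apply: QD => //; rewrite -mul_mpolyC; apply: (QM) => //.
rewrite mpolyXE_id; apply: (big_ind Q) => [||i _]; first by rewrite -mpolyC1.
  exact: QM.
by elim: (m i) => [|j IHj]; rewrite ?expr0 -?mpolyC1 // exprS; apply: QM.
Qed.

Lemma mderiv_var (R : realType) (N : nat) (x y : 'I_N) :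
  mderiv x (mpolyX R (mnm1 y)) = (x == y)%:R.
Proof.
rewrite mderivX mnm1E eq_sym; case: eqP => [->|_]; last by rewrite scale0r.
rewrite scale1r -mpolyX0; congr (mpolyX _ _); apply/mnmP => z.
by rewrite mnmBE subnn mnm0E.
Qed.

(** * Polynomials evaluated at one point *)

Section AtPoint.
Context (R : realType) (n d : nat) (i : 'I_n).

Lemma at_pointC (c : R) : at_point i (mpolyC d c) = mpolyC (ncoord n d) c.
Proof. by rewrite /at_point comp_mpolyC. Qed.

Lemma at_pointX (j : 'I_d) : at_point i (mpolyX R (mnm1 j)) = xvar R i j.
Proof. by rewrite /at_point comp_mpolyXU -tnth_nth tnth_mktuple. Qed.

Lemma at_pointD (f g : mpoly d R) :
  at_point i (f + g) = at_point i f + at_point i g.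
Proof. exact: comp_mpolyD. Qed.

Lemma at_pointM (f g : mpoly d R) :
  at_point i (f * g) = at_point i f * at_point i g.
Proof. by rewrite /at_point rmorphM. Qed.

Lemma at_pointZ (c : R) (f : mpoly d R) :
  at_point i (c *: f) = c *: at_point i f.
Proof. exact: comp_mpolyZ. Qed.

Lemma at_point0 : at_point i (0 : mpoly d R) = 0.
Proof. exact: comp_mpoly0. Qed.

Lemma at_point1 : at_point i (1 : mpoly d R) = 1.
Proof. exact: comp_mpoly1. Qed.

Lemma at_point_sum (I : Type) (r : seq I) (P : pred I) (F : I -> mpoly d R) :
  at_point i (\sum_(x <- r | P x) F x) = \sum_(x <- r | P x) at_point i (F x).
Proof. exact: (big_morph _ at_pointD at_point0). Qed.

Lemma at_point_prod (I : Type) (r : seq I) (P : pred I) (F : I -> mpoly d R) :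
  at_point i (\prod_(x <- r | P x) F x) = \prod_(x <- r | P x) at_point i (F x).
Proof. exact: (big_morph _ at_pointM at_point1). Qed.

Lemma mderiv_at_point (i' : 'I_n) (j : 'I_d) (f : mpoly d R) :
  mderiv (enum_rank (i', j)) (at_point i f)
  = if i' == i then at_point i (mderiv j f) else 0.
Proof.
elim/mpoly_generators_ind: f => [c|l|f g IHf IHg|f g IHf IHg].
- by rewrite at_pointC !mderivC at_point0 if_same.
- rewrite at_pointX !mderiv_var (inj_eq enum_rank_inj) xpair_eqE.
  by case: (i' == i) => //=; case: (j == l); rewrite ?at_point1 ?at_point0.
- by rewrite at_pointD !mderivD IHf IHg at_pointD; case: ifP; rewrite ?addr0.
- rewrite at_pointM !mderivM. rewrite IHf IHg.
  case: ifP => _; last by rewrite mul0r mulr0 addr0.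
  by rewrite at_pointD !at_pointM.
Qed.

Definition coords_of : {set 'I_(ncoord n d)} :=
  [set x | (enum_val x).1 == i].

Lemma depends_on_at_point (f : mpoly d R) : depends_on coords_of (at_point i f).
Proof.
move=> x; rewrite inE -{2}[x]enum_valK; case: (enum_val x) => i' j /= /negbTE ni.
by rewrite mderiv_at_point ni.
Qed.

Lemma derivs_at_point (s : seq 'I_d) (f : mpoly d R) :
  derivs [seq enum_rank (i, j) | j <- s] (at_point i f) = at_point i (derivs s f).
Proof.
elim: s => //= j s; rewrite /derivs /= => ->.
by rewrite mderiv_at_point eqxx.
Qed.

Lemma product_piE (pi : 'I_d -> 'I_d -> mpoly d R) (i1 i2 : 'I_n) (j1 j2 : 'I_d) :
  product_pi pi (enum_rank (i1, j1)) (enum_rank (i2, j2))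
  = if i1 == i2 then at_point i1 (pi j1 j2) else 0.
Proof. by rewrite /product_pi !enum_rankK. Qed.

(** Labels among the coordinates of one point are labels in [d], and on them the product bracket is
    the bracket of R^d evaluated at that point. *)
Lemma partial_star_at_point (w : forall k, graph k -> R)
    (pi : 'I_d -> 'I_d -> mpoly d R) (k : nat) (f g : mpoly d R) :
  partial_star w (product_pi pi) coords_of k (at_point i f) (at_point i g)
  = at_point i (\sum_(G : graph k) w k G *: bidiff pi G f g).
Proof.
rewrite /partial_star at_point_sum.
pose emb (D : graph k * {ffun edge k -> 'I_d}) : graph k * {ffun edge k -> _} :=
  (D.1, [ffun e => enum_rank (i, D.2 e)]).
pose proj (D : graph k * {ffun edge k -> 'I_(ncoord n d)}) :
  graph k * {ffun edge k -> 'I_d} := (D.1, [ffun e => (enum_val (D.2 e)).2]).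
rewrite (reindex_onto emb proj) /=; last first.
  move=> [G I] /forallP /= SI; congr (_, _); apply/ffunP => e; rewrite !ffunE /=.
  have := SI e; rewrite inE => /eqP <-.
  by rewrite -surjective_pairing enum_valK.
transitivity (\sum_(D : graph k * {ffun edge k -> 'I_d})
    w k D.1 *: at_point i (bidiff_term pi D.1 D.2 f g)).
  apply: eq_big => [[G I]|[G I] _] /=.
    apply/andP; split; first by apply/forallP => e; rewrite ffunE inE enum_rankK.
    by apply/eqP; congr (_, _); apply/ffunP => e; rewrite !ffunE enum_rankK.
  congr (_ *: _); rewrite /bidiff_term !at_pointM at_point_prod.
  have atE (v : vertex k) (h : mpoly d R) :
      deriv_at G [ffun e => enum_rank (i, I e)] v (at_point i h)
      = at_point i (deriv_at G I v h).
    rewrite !deriv_atE -derivs_at_point -map_comp; congr derivs.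
    by apply: eq_map => e /=; rewrite ffunE.
  rewrite !atE; congr (_ * _ * _); apply: eq_bigr => v _.
  by rewrite !ffunE product_piE eqxx atE.
rewrite -(pair_bigA _ (fun G I => w k G *: at_point i (bidiff_term pi G I f g))).
by apply: eq_bigr => G _; rewrite at_pointZ /bidiff at_point_sum scaler_sumr.
Qed.

End AtPoint.

(** * Products over all points and the factorials *)

Lemma sum_by_card (V : nmodType) (k : nat) (F : nat -> V) :
  \sum_(A : {set 'I_k}) F #|A| = \sum_(j < k.+1) F j *+ 'C(k, j).
Proof.
rewrite (partition_big (fun A : {set 'I_k} => inord #|A| : 'I_k.+1) xpredT) //=.
apply: eq_bigr => j _.
have cardE (A : {set 'I_k}) : (inord #|A| == j :> 'I_k.+1) = (#|A| == j).
  by rewrite -val_eqE /= inordK // ltnS -[leqRHS]card_ord max_card.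
under eq_bigl do rewrite cardE.
under eq_bigr => A /eqP -> do [].
rewrite sumr_const; congr (_ *+ _).
have := card_draws 'I_k j; rewrite card_ord => <-.
by apply: eq_card => A; rewrite inE.
Qed.

(** The division by [k!] turns the sum over the vertex sets of a piece, a binomial convolution, into
    the Cauchy product of [partial_star_coefM]. *)
Definition partial_star_coef (R : realType) (N : nat)
    (w : forall k, graph k -> R) (pi : 'I_N -> 'I_N -> mpoly N R)
    (S : {set 'I_N}) (k : nat) (f g : mpoly N R) : mpoly N R :=
  (k`!%:R)^-1 *: partial_star w pi S k f g.

Section PartialStarCoef.
Context (R : realType) (N : nat) (w : forall k, graph k -> R).
Context (pi : 'I_N -> 'I_N -> mpoly N R) (x0 : 'I_N).
Hypothesis (wM : glue_multiplicative w) (w0 : forall G : graph 0, w G = 1).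

Lemma partial_star_coefM (S1 S2 : {set 'I_N}) (f1 f2 g1 g2 : mpoly N R) (k : nat) :
  [disjoint S1 & S2] -> block_structure pi S1 S2 ->
  depends_on S1 f1 -> depends_on S2 f2 -> depends_on S1 g1 -> depends_on S2 g2 ->
  partial_star_coef w pi (S1 :|: S2) k (f1 * f2) (g1 * g2)
  = \sum_(j < k.+1) partial_star_coef w pi S1 j f1 g1
                    * partial_star_coef w pi S2 (k - j) f2 g2.
Proof.
move=> dS piS Sf1 Sf2 Sg1 Sg2.
rewrite {1}/partial_star_coef (partial_starM wM) //.
under eq_bigr => A _ do rewrite [#|~: A|]cardsCs finset.setCK card_ord.
rewrite (sum_by_card k (fun j => partial_star w pi S1 j f1 g1 *
  partial_star w pi S2 (k - j) f2 g2)) scaler_sumr.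
apply: eq_bigr => j _; rewrite /partial_star_coef -scalerAl -scalerAr scalerA.
rewrite -[X in _ *: X = _]scaler_nat scalerA; congr (_ *: _).
have jk : (j <= k)%N by rewrite -ltnS.
rewrite -invfM -natrM; apply: (canLR (mulKf _)).
  by rewrite pnatr_eq0 -lt0n fact_gt0.
by rewrite -(bin_fact jk) natrM mulfK // pnatr_eq0 -lt0n muln_gt0 !fact_gt0.
Qed.

(** Without coordinates no edge can be labelled, which leaves only the graph without vertices. This
    starts the induction over the points. *)
Lemma partial_star_coef_empty k :
  partial_star_coef w pi finset.set0 k 1 1 = (k == 0)%:R.
Proof.
rewrite /partial_star_coef /partial_star; case: k => [|k] /=.
  rewrite fact0 invr1 scale1r.
  have tG : @is_graph 0 [ffun e => vL 0] by apply/forallP => -[].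
  pose D0 : graph 0 * {ffun edge 0 -> 'I_N} := (Sub _ tG, [ffun e => x0]).
  rewrite (big_pred1 D0) => [|[G I]].
    rewrite w0 scale1r /bidiff_term big_ord0 !mul1r !deriv_atE.
    have -> : enum (edge 0) = [::].
      by apply: size0nil; rewrite -cardE card_prod card_ord.
    by rewrite /derivs /= mul1r.
  apply/idP/eqP => [_|_]; last by apply/forallP => -[[]].
  by congr (_, _); [apply/val_inj|]; apply/ffunP => -[[]].
rewrite big_pred0 ?scaler0 // => -[G I]; apply/negP => /forallP/(_ (ord0, true)).
by rewrite inE.
Qed.

Lemma depends_on_sub (S T : {set 'I_N}) (f : mpoly N R) :
  S \subset T -> depends_on S f -> depends_on T f.
Proof.
move=> ST Sf x xT; apply: Sf; apply: contra xT; exact: (fintype.subsetP ST).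
Qed.

Lemma depends_on1 (S : {set 'I_N}) : depends_on S (1 : mpoly N R).
Proof. by move=> x _; rewrite -mpolyC1 mderivC. Qed.

Lemma depends_onM (S : {set 'I_N}) (f g : mpoly N R) :
  depends_on S f -> depends_on S g -> depends_on S (f * g).
Proof. by move=> Sf Sg x xS; rewrite mderivM Sf // Sg // mul0r mulr0 addr0. Qed.

Section Points.
Context (n : nat) (S : 'I_n -> {set 'I_N}) (f g : 'I_n -> mpoly N R).
Hypothesis (disjS : forall i j, i != j -> [disjoint S i & S j]).
Hypothesis (pi0 : forall i j x y, i != j -> x \in S i -> y \in S j -> pi x y = 0).
Hypothesis (piS : forall i x y, x \in S i -> y \in S i -> depends_on (S i) (pi x y)).
Hypothesis (Sf : forall i, depends_on (S i) (f i)).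
Hypothesis (Sg : forall i, depends_on (S i) (g i)).

(** Iterated Cauchy products are products of polynomials in a formal variable. The truncation [M]
    stays fixed while [k] drops in the induction, and it does not affect coefficients up to [M]. *)
Lemma partial_star_coef_prod (M k : nat) (r : seq 'I_n) : uniq r -> (k <= M)%N ->
  partial_star_coef w pi (\bigcup_(i <- r) S i) k
    (\prod_(i <- r) f i) (\prod_(i <- r) g i)
  = (\prod_(i <- r) \poly_(j < M.+1) partial_star_coef w pi (S i) j (f i) (g i))`_k.
Proof.
elim: r k => [|i r IHr] k /= => [_ _|/andP[ir ur] kM].
  by rewrite !big_nil partial_star_coef_empty coef1.
have inU x : (x \in \bigcup_(j <- r) S j) = [exists j, (j \in r) && (x \in S j)].
  elim: (r) => [|j s IHs]; first by rewrite big_nil inE; apply/esym/existsP => -[].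
  rewrite big_cons inE IHs; apply/orP/existsP => [[xj|/existsP[l /andP[ls xl]]]|].
  - by exists j; rewrite mem_head.
  - by exists l; rewrite in_cons ls orbT.
  - move=> [l /andP[]]; rewrite in_cons => /predU1P[->|ls] xl; first by left.
    by right; apply/existsP; exists l; rewrite ls.
have Sr j : j \in r -> S j \subset \bigcup_(l <- r) S l.
  move=> jr; apply/fintype.subsetP => x xj; rewrite inU; apply/existsP.
  by exists j; rewrite jr.
have nij j : j \in r -> i != j by move=> jr; apply: contraNneq ir => ->.
have dep_prod (h : 'I_n -> mpoly N R) : (forall i, depends_on (S i) (h i)) ->
    depends_on (\bigcup_(l <- r) S l) (\prod_(l <- r) h l).
  move=> Sh; rewrite [\prod_(l <- r) _]big_seq; apply: (big_ind (depends_on _)).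
  - exact: depends_on1.
  - exact: depends_onM.
  - by move=> j jr; apply: depends_on_sub (Sh j); apply: Sr.
rewrite !big_cons partial_star_coefM //; first last.
- exact: dep_prod.
- exact: dep_prod.
- split=> [x y xi|x y|x y].
  + rewrite inU => /existsP[j /andP[/nij ij yj]].
    by rewrite (pi0 ij) // (@pi0 j i) // eq_sym.
  + exact: piS.
  + rewrite !inU => /existsP[j /andP[jr xj]] /existsP[l /andP[lr yl]].
    have [jl|jl] := eqVneq j l; last by rewrite (pi0 jl) // => z _; rewrite mderiv0.
    by apply: depends_on_sub (Sr _ jr) _; apply: piS => //; rewrite jl.
- apply/pred0P => x /=; apply/negP => /andP[xi].
  rewrite inU => /existsP[j /andP[/nij ij xj]].
  by move/pred0P/(_ x): (disjS ij); rewrite /= xi xj.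
rewrite coefM; apply: eq_bigr => j _.
have jM : (j < M.+1)%N by apply: leq_trans (ltn_ord j) _.
by rewrite coef_poly jM IHr // (leq_trans (leq_subr _ _)).
Qed.

End Points.
End PartialStarCoef.

Lemma labels_inT (N k : nat) (I : {ffun edge k -> 'I_N}) : labels_in [set: 'I_N] I.
Proof. by apply/forallP => e; rewrite inE. Qed.

Lemma star_coef_partial (R : realType) (N k : nat)
    (pi : 'I_N -> 'I_N -> mpoly N R) (f g : mpoly N R) :
  star_coef pi k f g = partial_star_coef (@weight R) pi [set: 'I_N] k f g.
Proof.
rewrite /star_coef /partial_star_coef /partial_star.
under [in RHS]eq_bigl do rewrite labels_inT.
rewrite -(pair_bigA _ (fun G I => weight R G *: bidiff_term pi G I f g)).
rewrite scaler_sumr; apply: eq_bigr => G _.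
by rewrite -scaler_sumr scalerA mulrC.
Qed.

Lemma star_coef_prod (R : realType) (n d m : nat)
    (pi : 'I_d -> 'I_d -> mpoly d R) (f g : 'I_n -> mpoly d R) :
  glue_multiplicative (@weight R) -> (forall G, @weight R 0 G = 1) ->
  (0 < n)%N -> (0 < d)%N ->
  star_coef (product_pi pi) m (\prod_i at_point i (f i)) (\prod_i at_point i (g i))
  = (\prod_i \poly_(j < m.+1) at_point i (star_coef pi j (f i) (g i)))`_m.
Proof.
(* [x0] is the default label needed for gluing; a coordinate exists because [n] and [d] are
   positive. *)
move=> wM w0 n0 d0; pose x0 := enum_rank (Ordinal n0, Ordinal d0).
rewrite star_coef_partial.
have -> : [set: 'I_(ncoord n d)] = \bigcup_(i <- index_enum 'I_n) coords_of d i.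
  apply/setP => x; rewrite inE -[x]enum_valK; case: (enum_val x) => i j.
  by apply/esym; rewrite (bigD1 i) //= !inE enum_rankK eqxx.
rewrite (@partial_star_coef_prod _ _ _ _ x0 wM w0 _ _ _ _ _ _ _ _ _ m) //.
- congr (nth 0 (polyseq _) m); apply: eq_bigr => i _; apply: eq_poly => j _.
  rewrite /partial_star_coef partial_star_at_point -at_pointZ /star_coef.
  congr at_point; rewrite scaler_sumr; apply: eq_bigr => G _.
  by rewrite scalerA mulrC.
- move=> i j ij; apply/pred0P => x; rewrite /= !inE.
  by apply/negP => /andP[/eqP xi /eqP xj]; move: ij; rewrite -xi -xj eqxx.
- move=> i j x y ij; rewrite -[x]enum_valK -[y]enum_valK !inE !enum_rankK.
  case: (enum_val x) (enum_val y) => [i1 j1] [i2 j2] /eqP /= -> /eqP ->.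
  by rewrite product_piE (negbTE ij).
- move=> i x y; rewrite -[x]enum_valK -[y]enum_valK !inE !enum_rankK.
  case: (enum_val x) (enum_val y) => [i1 j1] [i2 j2] /eqP /= -> /eqP ->.
  rewrite product_piE eqxx.
  exact: depends_on_at_point.
- by move=> i; apply: depends_on_at_point.
- by move=> i; apply: depends_on_at_point.
- exact: index_enum_uniq.
Qed.

(** * Integration over configurations *)

Local Open Scope classical_set_scope.
Local Open Scope ereal_scope.

(* Needed because the canonical structure declared last on [m1 \x m2] is the one
   for probability measures, which hides the sigma-finite one. *)
Definition with_sigma_finite d (T : measurableType d) (R : realType)
  (m : {measure set T -> \bar R}) (sf : sigma_finite setT m)
  : set T -> \bar R := m.

Section WithSigmaFinite.
Context d (T : measurableType d) (R : realType).
Context (m : {measure set T -> \bar R}) (sf : sigma_finite setT m).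

HB.instance Definition _ := measure_function.Measure.copy (with_sigma_finite sf) m.

HB.instance Definition _ :=
  Measure_isSigmaFinite.Build d T R (with_sigma_finite sf) sf.

End WithSigmaFinite.

Lemma sigma_finite_product d1 d2 (T1 : measurableType d1)
    (T2 : measurableType d2) (R : realType)
    (m1 : {sigma_finite_measure set T1 -> \bar R})
    (m2 : {sigma_finite_measure set T2 -> \bar R}) :
  sigma_finite setT (m1 \x m2).
Proof.
have [F FT Foo] := sigma_finiteT m1; have [G GT Goo] := sigma_finiteT m2.
pose h := choice.unpickle : nat -> option (nat * nat)%type.
exists (fun k => if h k is Some (i, j) then F i `*` G j else set0).
  apply/seteqP; split=> // -[x y] _.
  have [i _ Fx] : (\bigcup_i F i) x by rewrite -FT.
  have [j _ Gy] : (\bigcup_j G j) y by rewrite -GT.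
  by exists (choice.pickle (i, j)) => //; rewrite /h choice.pickleK.
move=> k; case: (h k) => [[i j]|]; last first.
  by split; [exact: measurable0|rewrite measure0].
have [mF Fi] := Foo i; have [mG Gj] := Goo j.
split; first exact: measurableX.
by rewrite product_measure1E // lte_mul_pinfty // ge0_fin_numE.
Qed.

(** * Powers of a sigma-finite measure *)

Section PowerMeasure.
Context d (T : measurableType d) (R : realType).
Context (mu : {sigma_finite_measure set T -> \bar R}).

Definition cons_pair (n : nat) (p : T * n.-tuple T) : n.+1.-tuple T :=
  cons_tuple p.1 p.2.

Lemma measurable_cons_pair (n : nat) : measurable_fun setT (@cons_pair n).
Proof. exact: measurable_cons. Qed.

(** [power_measure] is a bare set function given by iterated integrals of sections; as the image of
    a product measure it becomes a measure to which Tonelli applies. *)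
Lemma power_measureS (n : nat) : power_measure (n := n.+1) mu
  = pushforward (mu \x power_measure (n := n) mu) (@cons_pair n).
Proof.
apply/funext => A; rewrite /pushforward /product_measure1 /=.
apply: eq_integral => x _ /=; congr power_measure.
by apply/seteqP; split=> t; rewrite /xsection /= inE.
Qed.

Lemma measurable_uncons (n : nat) :
  measurable_fun setT (fun t : n.+1.-tuple T => (thead t, [tuple of behead t])).
Proof.
apply/measurable_fun_pairP; split; first exact: measurable_tnth.
exact: measurable_behead.
Qed.

(** An equation with a bundled measure, so that it can be destructed to rewrite the set function
    inside an integral. *)
Lemma power_measure_sigma_finite (n : nat) :
  {nu : {sigma_finite_measure set (n.-tuple T) -> \bar R} |
    power_measure (n := n) mu = nu}.
Proof.
elim: n => [|n [nu nuE]]; first by exists (\d_ ([tuple] : 0.-tuple T)).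
pose m0 : {measure set (n.+1.-tuple T) -> \bar R} :=
  pushforward (mu \x nu) (@cons_pair n).
pose m := m0 (@measurable_cons_pair n).
have sf : sigma_finite setT m.
  have [F FT Fm] := sigma_finite_product mu nu.
  exists (fun i => (fun t => (thead t, [tuple of behead t])) @^-1` F i).
    by rewrite -preimage_bigcup -FT.
  move=> i; have [mF Foo] := Fm i; split.
    by rewrite -[X in measurable X]setTI; apply: measurable_uncons.
  have -> : m ((fun t => (thead t, [tuple of behead t])) @^-1` F i)
      = (mu \x nu) (F i).
    congr ((mu \x nu) _); apply/seteqP.
    have E x (t : n.-tuple T) : [tuple of behead (cons_tuple x t)] = t.
      exact/val_inj.
    by split=> -[x t] /=; rewrite theadE E.
  exact: Foo.
by exists (with_sigma_finite sf); rewrite power_measureS nuE.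
Qed.

End PowerMeasure.

Section PowerIntegral.
Context d (T : measurableType d) (R : realType).
Context (mu : {sigma_finite_measure set T -> \bar R}).
Local Notation power n := (power_measure (n := n) mu).

Lemma measurable_cons_tuple (n : nat) (x : T) :
  measurable_fun setT (fun t : n.-tuple T => cons_tuple x t).
Proof. by apply: measurable_cons => //; apply: measurable_id. Qed.

Section Tonelli.
Context (n : nat) (f : n.+1.-tuple T -> \bar R).
Hypothesis (mf : measurable_fun setT f) (f0 : forall t, 0 <= f t).

Lemma integral_powerS :
  \int[power n.+1]_z f z = \int[mu]_x \int[power n]_t f (cons_tuple x t).
Proof.
have [nu nuE] := power_measure_sigma_finite mu n.
rewrite power_measureS nuE ge0_integral_pushforward //; last exact: measurable_cons_pair.
rewrite preimage_setT fubini_tonelli1 //=.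
by apply: measurableT_comp => //; exact: measurable_cons_pair.
Qed.

Lemma measurable_integral_power :
  measurable_fun setT (fun x => \int[power n]_t f (cons_tuple x t)).
Proof.
have [nu nuE] := power_measure_sigma_finite mu n; rewrite nuE.
apply: (@measurable_fun_fubini_tonelli_F _ _ _ _ _ nu (f \o @cons_pair _ _ n)).
  by apply: measurableT_comp => //; exact: measurable_cons_pair.
by move=> p /=.
Qed.

End Tonelli.

(** Selecting coordinates by a mask rather than by a set of indices lets the proofs peel off one
    coordinate at a time. *)
Definition mask_tuple (bm : seq bool) (z : (size bm).-tuple T) :
    (count id bm).-tuple T :=
  Tuple (introT eqP (size_mask (esym (size_tuple z)))).

Lemma measurable_mask_tuple (bm : seq bool) :
  measurable_fun setT (@mask_tuple bm).
Proof.
elim: bm => [|b bm IHbm].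
  by apply/measurable_fun_tnthP => -[].
have mB : measurable_fun setT (fun z : (size bm).+1.-tuple T =>
    mask_tuple [tuple of behead z]).
  by apply: measurableT_comp => //; exact: measurable_behead.
case: b.
  have -> : @mask_tuple (true :: bm) =
      (fun z => cons_tuple (thead z) (mask_tuple [tuple of behead z])).
    apply/funext => z; apply/val_inj => /=.
    by case/tupleP: z => x z /=; rewrite theadE.
  by apply: measurable_cons => //; exact: measurable_tnth.
have -> : @mask_tuple (false :: bm) =
    (fun z => mask_tuple [tuple of behead z]).
  by apply/funext => z; apply/val_inj => /=; case/tupleP: z.
exact: mB.
Qed.

Lemma measurable_mask (bm : seq bool) d' (U : measurableType d')
    (F : seq T -> U) :
  measurable_fun setT (fun z : (count id bm).-tuple T => F z) ->
  measurable_fun setT (fun z : (size bm).-tuple T => F (mask bm z)).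
Proof.
move=> mF.
have H := measurableT_comp mF (@measurable_mask_tuple bm).
exact: H.
Qed.

Lemma count_negb (bm : seq bool) :
  count id (map negb bm) = count negb bm.
Proof. by rewrite count_map; apply: eq_count. Qed.

Lemma measurable_mask_negb (bm : seq bool) d' (U : measurableType d')
    (F : seq T -> U) :
  measurable_fun setT (fun z : (count negb bm).-tuple T => F z) ->
  measurable_fun setT (fun z : (size bm).-tuple T => F (mask (map negb bm) z)).
Proof. by rewrite -count_negb => /measurable_mask; rewrite size_map. Qed.

Lemma measurable_cons_section (n : nat) (x : T) d' (U : measurableType d')
    (F : seq T -> U) :
  measurable_fun setT (fun z : n.+1.-tuple T => F z) ->
  measurable_fun setT (fun z : n.-tuple T => F (x :: z)).
Proof. by move=> mF; exact: (measurableT_comp mF (@measurable_cons_tuple n x)). Qed.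

(** The first bit tells whether the outermost variable belongs to [F] or to [H]; the inner integral
    of the other function is then a constant factor. [F] and [H] take lists, so that fixing the
    first entry gives a function of the same type. *)
Lemma integral_power_shuffle (bm : seq bool) (F H : seq T -> \bar R) :
  (forall s, 0 <= F s) -> (forall s, 0 <= H s) ->
  measurable_fun setT (fun z : (count id bm).-tuple T => F z) ->
  measurable_fun setT (fun z : (count negb bm).-tuple T => H z) ->
  \int[power (size bm)]_z (F (mask bm z) * H (mask (map negb bm) z))
  = \int[power (count id bm)]_z F z * \int[power (count negb bm)]_z H z.
Proof.
elim: bm F H => [|b bm IHbm] F H F0 H0 mF mH.
  have mFH : measurable_fun setT (fun z : 0.-tuple T => F [::] * H [::]) by [].
  rewrite /= !integral_dirac //= !diracT.
  by rewrite !mul1e.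
have mFH : measurable_fun setT (fun z : (size (b :: bm)).-tuple T =>
    F (mask (b :: bm) z) * H (mask (map negb (b :: bm)) z)).
  by apply: emeasurable_funM; [exact: measurable_mask|exact: measurable_mask_negb].
rewrite (integral_powerS mFH) => [|t]; last exact: mule_ge0.
have [nu nuE] := power_measure_sigma_finite mu (count id bm).
have [nu' nu'E] := power_measure_sigma_finite mu (count negb bm).
case: b mF mH mFH => /= mF mH mFH.
  have E x := IHbm (fun s => F (x :: s)) H (fun=> F0 _) H0
    (measurable_cons_section x mF) mH.
  under eq_integral => x _ do rewrite E.
  rewrite (integral_powerS mF) // ge0_integralZr //.
  - exact: measurable_integral_power mF _.
  - by move=> x _; rewrite nuE; apply: integral_ge0.
  - by rewrite nu'E; apply: integral_ge0.
have E x := IHbm F (fun s => H (x :: s)) F0 (fun=> H0 _) mF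
  (measurable_cons_section x mH).
under eq_integral => x _ do rewrite E.
rewrite (integral_powerS mH) // ge0_integralZl //.
- exact: measurable_integral_power mH _.
- by move=> x _; rewrite nu'E; apply: integral_ge0.
- by rewrite nuE; apply: integral_ge0.
Qed.

End PowerIntegral.

(** The variables stand for the integrals of the positive and negative parts of two functions. A
    difference with an infinite term has [fine] equal to 0, even when both terms are infinite; if
    the other pair is zero, the convention that 0 times infinity is 0 gives the same value. *)
Lemma fine_subM (R : realType) (a a' b b' : \bar R) :
  0 <= a -> 0 <= a' -> 0 <= b -> 0 <= b' ->
  fine ((a * b + a' * b') - (a * b' + a' * b)) = (fine (a - a') * fine (b - b'))%R.
Proof.
have fine_sub_pinfty (x y : \bar R) : 0 <= x -> 0 <= y ->
    x = +oo \/ y = +oo -> fine (x - y) = 0%R.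
  by case: x => [x| |] // _; case: y => [y| |] // _ [].
have add_pinfty (x y : \bar R) : 0 <= x -> 0 <= y -> x = +oo \/ y = +oo -> x + y = +oo.
  by case: x => [x| |] // _; case: y => [y| |] // _ [].
have key (x x' y y' : \bar R) : 0 <= x -> 0 <= x' -> 0 <= y -> 0 <= y' ->
    y = +oo \/ y' = +oo ->
    fine ((x * y + x' * y') - (x * y' + x' * y)) = 0%R.
  move=> x0 x'0 y0 y'0 yoo.
  have [->|xn0] := eqVneq x 0; have [->|x'n0] := eqVneq x' 0.
  - by rewrite !mul0e !adde0 sube0.
  - rewrite !mul0e !add0e; apply: fine_sub_pinfty; rewrite ?mule_ge0 //.
    by case: yoo => ->; [right|left]; rewrite gt0_muley // lt0e x'n0.
  - rewrite !mul0e !adde0; apply: fine_sub_pinfty; rewrite ?mule_ge0 //.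
    by case: yoo => ->; [left|right]; rewrite gt0_muley // lt0e xn0.
  - apply: fine_sub_pinfty; rewrite ?adde_ge0 ?mule_ge0 //.
    left; apply: add_pinfty; rewrite ?mule_ge0 //.
    case: yoo => ->; [left|right]; rewrite gt0_muley // lt0e.
      by rewrite xn0.
    by rewrite x'n0.
move=> a0 a'0 b0 b'0.
have [boo|/not_orP[bf b'f]] := pselect (b = +oo \/ b' = +oo).
  by rewrite key // (fine_sub_pinfty b b') // mulr0.
have [aoo|/not_orP[af a'f]] := pselect (a = +oo \/ a' = +oo).
  rewrite (fine_sub_pinfty a a') // mul0r (muleC a) (muleC a') (muleC a b') (muleC a' b).
  by rewrite (addeC (b' * a)) key.
case: a a0 af => [a| |] // _ _; case: a' a'0 a'f => [a'| |] // _ _.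
case: b b0 bf => [b| |] // _ _; case: b' b'0 b'f => [b'| |] // _ _.
rewrite /= mulrBl !mulrBr; lra.
Qed.

(** The positive part of a product; applied to [x] and [- y] it also yields the negative part. *)
Lemma max0M (R : realDomainType) (x y : R) :
  (Num.max (x * y) 0 = Num.max x 0 * Num.max y 0
    + Num.max (- x) 0 * Num.max (- y) 0)%R.
Proof.
have pos (z : R) : (0 <= z -> Num.max z 0 = z)%R by move=> ?; apply: max_l.
have neg (z : R) : (z <= 0 -> Num.max z 0 = 0)%R by move=> ?; apply: max_r.
have /orP[x0|x0] := le_total 0%R x; have /orP[y0|y0] := le_total 0%R y.
- by rewrite (pos (x * y))%R ?mulr_ge0 // (pos x) // (pos y) // (neg (- x)%R) ?oppr_le0 //
    mul0r addr0.
- by rewrite (neg (x * y))%R ?mulr_ge0_le0 // (neg y) // (neg (- x)%R) ?oppr_le0 //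
    mulr0 mul0r addr0.
- by rewrite (neg (x * y))%R ?mulr_le0_ge0 // (neg x) // (neg (- y)%R) ?oppr_le0 //
    mulr0 mul0r addr0.
- by rewrite (pos (x * y))%R ?mulr_le0 // (neg x) // mul0r add0r
    (pos (- x)%R) ?(pos (- y)%R) ?oppr_ge0 // mulrNN.
Qed.

Section PowerIntegralSigned.
Context d (T : measurableType d) (R : realType).
Context (mu : {sigma_finite_measure set T -> \bar R}).
Local Notation power n := (power_measure (n := n) mu).

(** Fubini would require integrability. Instead Tonelli is applied to the four products of positive
    and negative parts, and [fine_subM] reassembles the result. *)
Lemma fine_integral_power_shuffle (bm : seq bool) (F H : seq T -> R) :
  measurable_fun setT (fun z : (count id bm).-tuple T => F z) ->
  measurable_fun setT (fun z : (count negb bm).-tuple T => H z) ->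
  fine (\int[power (size bm)]_z (F (mask bm z) * H (mask (map negb bm) z))%:E)
  = (fine (\int[power (count id bm)]_z (F z)%:E)
     * fine (\int[power (count negb bm)]_z (H z)%:E))%R.
Proof.
move=> mF mH.
pose pos (K : seq T -> R) s : \bar R := (Num.max (K s) 0)%:E.
pose neg (K : seq T -> R) s : \bar R := (Num.max (- K s) 0)%:E.
have pos0 K s : 0 <= pos K s by rewrite lee_fin le_max lexx orbT.
have neg0 K s : 0 <= neg K s by rewrite lee_fin le_max lexx orbT.
have mpos n (K : seq T -> R) : measurable_fun setT (fun z : n.-tuple T => K z : R) ->
    measurable_fun setT (fun z : n.-tuple T => pos K z).
  by move=> mK; apply/measurable_EFinP; apply: measurable_maxr.
have mneg n (K : seq T -> R) : measurable_fun setT (fun z : n.-tuple T => K z : R) ->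
    measurable_fun setT (fun z : n.-tuple T => neg K z).
  move=> mK; apply/measurable_EFinP; apply: measurable_maxr => //.
  exact: measurableT_comp.
have intE n (K : seq T -> R) : \int[power n]_z (K z)%:E =
    \int[power n]_z pos K z - \int[power n]_z neg K z.
  have [nu ->] := power_measure_sigma_finite mu n.
  rewrite integralE; congr (_ - _); apply: eq_integral => z _.
    by rewrite funeposE /pos EFin_max.
  by rewrite funenegE /neg EFin_max.
have [nu nuE] := power_measure_sigma_finite mu (size bm).
have mpos_mask := measurable_mask (mpos _ _ mF).
have mneg_mask := measurable_mask (mneg _ _ mF).
have mpos_negb := measurable_mask_negb (mpos _ _ mH).
have mneg_negb := measurable_mask_negb (mneg _ _ mH).
have int0 n (f : n.-tuple T -> \bar R) : (forall z, 0 <= f z) ->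
    0 <= \int[power n]_z f z.
  by have [? ->] := power_measure_sigma_finite mu n => f0; apply: integral_ge0.
rewrite !intE -fine_subM ?int0 //.
rewrite -!integral_power_shuffle //; try by [apply: mneg | apply: mpos].
rewrite nuE -!ge0_integralD //; first last.
all: try by [move=> *; rewrite mule_ge0 | apply: emeasurable_funM].
rewrite [X in fine X = _]integralE; congr (fine (_ - _)); apply: eq_integral => z _.
  by rewrite funeposE /pos /neg -!EFinM -EFinD -EFin_max max0M.
by rewrite funenegE /pos /neg -!EFinM -EFinD -EFinN -EFin_max -mulrN max0M opprK.
Qed.

End PowerIntegralSigned.

(** * Coincidences of points are null *)

Section NullSets.
Context d (T : measurableType d) (R : realType).
Context (mu : {sigma_finite_measure set T -> \bar R}).
Hypothesis (mu1 : forall x, mu [set x] = 0) (m1 : forall x : T, measurable [set x]).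
Local Notation power n := (power_measure (n := n) mu).

Lemma power_hyperplane (n : nat) (v : 'I_n) (x : T) :
  power n [set t | tnth t v = x] = 0.
Proof.
elim: n v => [[]//|n IHn] v; rewrite /=.
case: (unliftP ord0 v) => [w ->|->].
  rewrite -[RHS](integral0 mu setT); apply: eq_integral => y _ /=.
  rewrite -[RHS](IHn w); congr power_measure; apply/seteqP.
  by split=> t /=; rewrite tnthS.
have [nu nuE] := power_measure_sigma_finite mu n.
transitivity (\int[mu]_y (nu setT * (\1_[set x] y)%:E)).
  apply: eq_integral => y _; rewrite nuE indicE.
  case: (boolP (y \in [set x])) => [|nyx].
    move/set_mem => /= ->; rewrite mule1; congr (nu _); apply/seteqP.
    by split=> // t _ /=; rewrite tnth0.
  rewrite mule0 -[RHS](measure0 nu); congr (nu _); apply/seteqP.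
  split=> // t /=; rewrite tnth0 => yx.
  by move/negP: nyx; apply; apply/mem_set.
rewrite ge0_integralZl //.
- rewrite integral_indic // setIT.
  by rewrite [X in _ * X](_ : _ = 0) ?mule0 //; exact: mu1.
- by apply/measurable_EFinP; apply: measurable_indic.
Qed.

(** With the first point fixed, the section is a diagonal of the other points, or a hyperplane if
    the first point is one of the two. *)
Lemma power_diagonal (n : nat) (v w : 'I_n) : v != w ->
  power n [set t | tnth t v = tnth t w] = 0.
Proof.
elim: n v w => [[]//|n IHn] v w vw /=.
rewrite -[RHS](integral0 mu setT); apply: eq_integral => y _ /=.
case: (unliftP ord0 v) vw => [v' ->|->]; case: (unliftP ord0 w) => [w' ->|->] vw.
- rewrite -[RHS](IHn v' w'); last by apply: contraNneq vw => ->.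
  by congr power_measure; apply/seteqP; split=> t /=; rewrite !tnthS.
- rewrite -[RHS](power_hyperplane v' y); congr power_measure.
  by apply/seteqP; split=> t /=; rewrite !tnthS tnth0.
- rewrite -[RHS](power_hyperplane w' y); congr power_measure.
  by apply/seteqP; split=> t /=; rewrite !tnthS tnth0 => ->.
- by rewrite eqxx in vw.
Qed.

End NullSets.

Local Close Scope ereal_scope.

(** * The Kontsevich weights *)

Import numFieldNormedType.Exports.

(** * The differential of an angle *)

Lemma cos_sin_inj (R : realType) (s t : R) : - pi < s <= pi -> - pi < t <= pi ->
  cos s = cos t -> sin s = sin t -> s = t.
Proof.
move=> /andP[s1 s2] /andP[t1 t2] cst sst.
have c1 : cos (s - t) = 1 by rewrite cosB cst sst -!expr2 cos2Dsin2.
(* The half angle lies strictly between [- pi] and [pi], where the sine vanishes only at 0;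
   [cos (s - t) = 1] makes its sine vanish. *)
pose u := (s - t) / 2.
have uE : s - t = u *+ 2 by rewrite /u mulr2n -splitr.
have su : sin u = 0.
  apply/eqP; rewrite -[_ == 0](@expf_eq0 _ _ 2) sin2cos2.
  by move: c1; rewrite uE cos_mulr2n; move=> c1; apply/eqP; lra.
have u1 : - pi < u by rewrite /u; lra.
have u2 : u < pi by rewrite /u; lra.
suff u0 : u = 0 by lra.
have [u0|u0|//] := ltgtP u 0; exfalso.
  have : 0 < sin (- u) by apply: sin_gt0_pi; apply/andP; split; lra.
  by rewrite sinN su oppr0 ltxx.
have : 0 < sin u by apply: sin_gt0_pi; apply/andP; split; lra.
by rewrite su ltxx.
Qed.

(** In the right half plane the argument selected by [xget] is an explicit differentiable function.
    This is enough, since angles are differentiated through ratios close to 1; the factor [c]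
    absorbs a real denominator. *)
Lemma principal_arg_atan (R : realType) (c u v : R) : 0 < c -> 0 < u ->
  principal_arg ((c * u) +i* (c * v))%C = atan (v / u).
Proof.
move=> c0 u0; rewrite /principal_arg.
set z := (_ +i* _)%C; set t := atan _.
have nz : `|z| = (c * Num.sqrt (u ^+ 2 + v ^+ 2) +i* 0)%C.
  rewrite normc_def /=; congr (_ +i* _)%C.
  by rewrite !exprMn -mulrDr sqrtrM ?sqr_ge0 // sqrtr_sqr gtr0_norm.
have s0 : 0 < u ^+ 2 + v ^+ 2 by rewrite ltr_wpDr ?sqr_ge0 // exprn_gt0.
have ct : cos t = u / Num.sqrt (u ^+ 2 + v ^+ 2).
  rewrite /t cos_atan -[LHS]mul1r.
  have -> : 1 + (v / u) ^+ 2 = (u ^+ 2 + v ^+ 2) / u ^+ 2.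
    by field; rewrite gt_eqF.
  rewrite sqrtrM ?ltW // sqrtrV ?sqr_ge0 // sqrtr_sqr gtr0_norm //.
  by rewrite mul1r invfM invrK mulrC.
have st : sin t = v / Num.sqrt (u ^+ 2 + v ^+ 2).
  have := atanK (v / u); rewrite -/t /tan ct => /(canRL (mulfVK _)) -> //.
    by field; rewrite sqrtr_eq0 -ltNge s0 gt_eqF.
  by rewrite mulf_neq0 ?invr_eq0 ?gt_eqF // sqrtr_gt0.
have sq0 : Num.sqrt (u ^+ 2 + v ^+ 2) != 0 by rewrite gt_eqF // sqrtr_gt0.
apply: xget_subset1.
  split.
    rewrite /t; have := atan_gtNpi2 (v / u); have := atan_ltpi2 (v / u).
    have := pi_gt0 R => *; apply/andP; split; lra.
  rewrite nz ct st; apply/eqP; rewrite eq_complex /=.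
  by apply/andP; split; apply/eqP; field; rewrite sq0.
move=> x y [xpi zx] [ypi zy]; apply: cos_sin_inj => //.
  move: zy; rewrite {1}zx nz => -[+ _]; rewrite !mul0r !subr0.
  exact: mulfI (mulf_neq0 (lt0r_neq0 c0) sq0) _ _.
move: zy; rewrite {1}zx nz => -[_ +]; rewrite !mul0r !addr0.
exact: mulfI (mulf_neq0 (lt0r_neq0 c0) sq0) _ _.
Qed.

(* The derivative of [arg (a + ib)] in the direction [(da, db)]. *)
Definition darg (R : realType) (a b da db : R) : R :=
  (a * db - b * da) / (a ^+ 2 + b ^+ 2).

Lemma complex_neq0 (R : rcfType) (a b : R) :
  a ^+ 2 + b ^+ 2 != 0 -> (a +i* b)%C != 0.
Proof.
by apply: contraNneq => -[-> ->]; rewrite expr0n addr0.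
Qed.

Lemma is_derive_arg_ratio (R : realType) (a b da db a' b' da' db' : R)
    (r : R -> R[i]) :
  a ^+ 2 + b ^+ 2 != 0 -> a' ^+ 2 + b' ^+ 2 != 0 ->
  (forall t, r t = ((a + t * da) +i* (b + t * db))%C
                   / ((a' + t * da') +i* (b' + t * db'))%C) ->
  is_derive (0 : R) 1 (fun t => principal_arg (r t / r 0))
    (darg a b da db - darg a' b' da' db').
Proof.
move=> n0 n'0 rE.
(* [z t = z 0 * (1 + t al + i t ga)], and likewise for the denominator. *)
pose al := (a * da + b * db) / (a ^+ 2 + b ^+ 2).
pose al' := (a' * da' + b' * db') / (a' ^+ 2 + b' ^+ 2).
set ga := darg a b da db; set ga' := darg a' b' da' db'.
(* The ratio [r t / r 0] is [(U + i V) / D]. Near 0 both [U] and [D] are positive, so its argument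
   is [atan (V / U)], whose derivative at 0 is that of [V] because [V] vanishes and [U] is 1
   there. *)
pose U : {poly R} := (1 + al *: 'X) * (1 + al' *: 'X) + (ga * ga') *: 'X^2.
pose V : {poly R} := ga *: 'X * (1 + al' *: 'X) - ga' *: 'X * (1 + al *: 'X).
pose D : {poly R} := (1 + al' *: 'X) ^+ 2 + (ga' *: 'X) ^+ 2.
have near_gt0 (p : {poly R}) : p.[0] = 1 -> \forall t \near (0 : R), 0 < p.[t].
  move=> p0; have cp : horner p t @[t --> (0 : R)] --> p.[0].
    exact: continuous_horner.
  by rewrite p0 in cp; apply: (cvgr_gt _ cp).
have U0 : U.[0] = 1 by rewrite /U !hornerE /=; ring.
have D0 : D.[0] = 1 by rewrite /D !hornerE /=; ring.
have V0 : V.[0] = 0 by rewrite /V !hornerE /=; ring.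
have argE : \forall t \near (0 : R),
    atan (V.[t] * (U.[t])^-1) = principal_arg (r t / r 0).
  near=> t.
  have Ut : 0 < U.[t] by near: t; exact: near_gt0.
  have Dt : 0 < D.[t] by near: t; exact: near_gt0.
  rewrite -(@principal_arg_atan _ (D.[t])^-1) ?invr_gt0 //; congr principal_arg.
  have DE : D.[t] = (1 + al' * t) ^+ 2 + (ga' * t) ^+ 2 by rewrite /D !hornerE /=; ring.
  have UE : U.[t] = (1 + al * t) * (1 + al' * t) + ga * ga' * t ^+ 2.
    by rewrite /U !hornerE /=; ring.
  have VE : V.[t] = ga * t * (1 + al' * t) - ga' * t * (1 + al * t).
    by rewrite /V !hornerE /=; ring.
  rewrite !rE !mul0r !addr0.
  have -> : ((a + t * da) +i* (b + t * db))%C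
      = (a +i* b)%C * ((1 + al * t) +i* (ga * t))%C.
    apply/eqP; rewrite eq_complex /= /al /ga /darg.
    by apply/andP; split; apply/eqP; field; rewrite n0.
  have -> : ((a' + t * da') +i* (b' + t * db'))%C
      = (a' +i* b')%C * ((1 + al' * t) +i* (ga' * t))%C.
    apply/eqP; rewrite eq_complex /= /al' /ga' /darg.
    by apply/andP; split; apply/eqP; field; rewrite n'0.
  have -> : ((1 + al * t) +i* (ga * t))%C
      = ((D.[t])^-1 * U.[t] +i* ((D.[t])^-1 * V.[t]))%C
        * ((1 + al' * t) +i* (ga' * t))%C.
    apply/eqP; rewrite eq_complex /= DE UE VE.
    move: Dt; rewrite DE => /lt0r_neq0 Dt.
    by apply/andP; split; apply/eqP; field; rewrite Dt.
  have z0 := complex_neq0 n0; have z'0 := complex_neq0 n'0.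
  have P'0 : ((1 + al' * t) +i* (ga' * t))%C != 0.
    by apply: complex_neq0; rewrite -DE gt_eqF.
  by field; rewrite P'0 z0 z'0.
apply: near_eq_is_derive argE _.
have dU := is_derive_poly U 0; have dV := is_derive_poly V 0.
have dUV : is_derive (0 : R) 1 (fun t => (U.[t])^-1) (- (U.[0]) ^- 2 *: U^`().[0]).
  by apply: is_deriveV; rewrite U0 oner_neq0.
have dq := is_deriveM dV dUV.
have := @is_derive1_comp R atan (fun t => V.[t] * (U.[t])^-1) 0 _ _
  (is_derive1_atan _) dq.
rewrite /= V0 mul0r expr0n addr0 invr1 mul1r U0 invr1 scale0r add0r scale1r.
suff -> : V^`().[0] = ga - ga' by [].
by rewrite /V !poly.derivE !hornerE /=; ring.
Unshelve. all: by end_near.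
Qed.

(* The angle form of Defs, made explicit and read off the list of the positions
   of the points, so that a subgraph can be evaluated on a sublist. *)
Section ExplicitForm.
Context (R : realType) (k : nat).
Implicit Types (s : seq (plane R)) (w : vertex k) (c : 'I_k * bool).

Definition xcoord s w : R :=
  match w with inl v => (nth (0, 0) s v).1 | inr b => b%:R end.

Definition ycoord s w : R :=
  match w with inl v => (nth (0, 0) s v).2 | inr _ => 0 end.

Definition dxcoord c w : R := ((w == inl c.1) && ~~ c.2)%:R.

Definition dycoord c w : R := ((w == inl c.1) && c.2)%:R.

(** Numerator minus denominator of the ratio defining the angle; conjugating the source flips the
    sign of its ordinate in the second term. *)
Definition explicit_dangle (G : graph k) s (e : edge k) c : R :=
  let v := inl e.1 in
  let w := target G e in
  darg (xcoord s w - xcoord s v) (ycoord s w - ycoord s v)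
       (dxcoord c w - dxcoord c v) (dycoord c w - dycoord c v)
  - darg (xcoord s w - xcoord s v) (ycoord s w + ycoord s v)
         (dxcoord c w - dxcoord c v) (dycoord c w + dycoord c v).

Definition explicit_form (G : graph k) s : R :=
  \det (\matrix_(i < #|{: 'I_k * bool}|, j < #|{: 'I_k * bool}|)
          explicit_dangle G s (enum_val i) (enum_val j)).

Lemma pos_move (z : k.-tuple (plane R)) c (t : R) w :
  pos (move z c t) w
  = ((xcoord z w + t * dxcoord c w) +i* (ycoord z w + t * dycoord c w))%C.
Proof.
case: w => [v|b] /=; rewrite /dxcoord /dycoord.
  rewrite tnth_mktuple -!tnth_nth.
  have -> : (inl v == inl c.1 :> vertex k) = (v == c.1) by [].
  by case: eqP => _; case: c.2; rewrite /= ?mulr1 ?mulr0 ?addr0.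
by case: b; rewrite /= !mulr0 !addr0.
Qed.

Lemma move0 (z : k.-tuple (plane R)) c : move z c 0 = z.
Proof.
apply/eq_from_tnth => v; rewrite tnth_mktuple; case: eqP => // _.
by rewrite !if_same !addr0 -surjective_pairing.
Qed.

Lemma target_neq (G : graph k) (v : 'I_k) b : target G (v, b) != inl v.
Proof. by have /forallP/(_ v)/and3P[_ ? ?] := valP G; case: b. Qed.

Lemma dangleE (G : graph k) (z : k.-tuple (plane R)) e c :
  half_plane_conf z -> dangle G z e c = explicit_dangle G z e c.
Proof.
move=> [z_gt0 z_inj].
pose r t := edge_ratio G e (move z c t).
have r0 : edge_ratio G e z = r 0 by rewrite /r move0.
set v : vertex k := inl e.1; set w := target G e.
have yv : 0 < ycoord z v by rewrite /= -tnth_nth.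
have yw : 0 <= ycoord z w by case: w => [u|b] //=; rewrite -tnth_nth ltW.
(* Source and target differ: two vertices of a configuration are distinct points, and L and R lie on
   the real axis. *)
have n0 : (xcoord z w - xcoord z v) ^+ 2 + (ycoord z w - ycoord z v) ^+ 2 != 0.
  rewrite paddr_eq0 ?sqr_ge0 // !sqrf_eq0 !subr_eq0.
  apply/negP => /andP[/eqP Ex /eqP Ey].
  have := target_neq G e.1 e.2; rewrite -surjective_pairing -/w.
  case: w Ex Ey yw => [u|b] /= Ex Ey _ uv; last first.
    by move: yv; rewrite /= -Ey ltxx.
  apply: (z_inj u e.1); first by apply: contra_neq uv => ->.
  move: Ex Ey; rewrite -!tnth_nth.
  by case: (tnth z u) (tnth z e.1) => [? ?] [? ?] /= -> ->.
(* The conjugate of the source lies in the open lower half plane, the target in the closed upper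
   one. *)
have n'0 : (xcoord z w - xcoord z v) ^+ 2 + (ycoord z w + ycoord z v) ^+ 2 != 0.
  by rewrite gt_eqF // ltr_wpDl ?sqr_ge0 // exprn_gt0 // ltr_wpDl.
have rE t : r t =
    (((xcoord z w - xcoord z v) + t * (dxcoord c w - dxcoord c v)) +i*
     ((ycoord z w - ycoord z v) + t * (dycoord c w - dycoord c v)))%C /
    (((xcoord z w - xcoord z v) + t * (dxcoord c w - dxcoord c v)) +i*
     ((ycoord z w + ycoord z v) + t * (dycoord c w + dycoord c v)))%C.
  rewrite /r /edge_ratio !pos_move -/v -/w; congr (_ / _).
    by apply/eqP; rewrite eq_complex /=; apply/andP; split; apply/eqP; ring.
  by apply/eqP; rewrite eq_complex /=; apply/andP; split; apply/eqP; ring.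
have D := is_derive_arg_ratio n0 n'0 rE.
rewrite /dangle derive1E /edge_angle r0.
have D' : is_derive (0 : R) 1 (cst (principal_arg (r 0)) +
    (fun t => principal_arg (r t / r 0))) (0 + explicit_dangle G z e c).
  exact: is_deriveD.
by rewrite add0r in D'; have -> := @derive_val _ _ _ _ _ _ _ D'.
Qed.

Lemma angle_formE (G : graph k) (z : k.-tuple (plane R)) :
  half_plane_conf z -> angle_form G z = explicit_form G z.
Proof.
move=> zc; rewrite /angle_form /explicit_form; congr (\det _).
by apply/matrixP => i j; rewrite !mxE dangleE.
Qed.

End ExplicitForm.

(** * Determinants of glued graphs *)

Section FinDet.
Context (R : comNzRingType).

(** Another enumeration permutes rows and columns alike, so the two signs cancel. *)
Lemma det_reindex (T : Type) (m n : nat) (f : T -> T -> R)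
    (g : 'I_m -> T) (h : 'I_n -> T) : bijective g -> bijective h ->
  \det (\matrix_(i, j) f (g i) (g j)) = \det (\matrix_(i, j) f (h i) (h j)).
Proof.
move=> [g' gK g'K] [h' hK h'K].
have mn : m = n.
  have : bijective (h' \o g) by exists (g' \o h) => i /=; rewrite ?h'K ?gK ?g'K ?hK.
  by move/bij_eq_card; rewrite !card_ord.
subst m; have s_inj : injective (g' \o h).
  by apply: (can_inj (g := h' \o g)) => i /=; rewrite g'K hK.
pose s := perm s_inj.
have -> : \matrix_(i, j) f (h i) (h j)
    = row_perm s (col_perm s (\matrix_(i, j) f (g i) (g j))).
  by apply/matrixP => i j; rewrite !mxE !permE /= !g'K.
rewrite row_permE col_permE !det_mulmx !det_perm ?odd_permV mulrC -mulrA.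
by rewrite -signr_addb addbb mulr1.
Qed.

Lemma det_sum_blocks (T T1 T2 : finType) (h1 : T1 -> T) (h2 : T2 -> T)
    (f : T -> T -> R) (f1 : T1 -> T1 -> R) (f2 : T2 -> T2 -> R) :
  injective h1 -> injective h2 -> (forall x y, h1 x != h2 y) ->
  (forall z, (exists x, z = h1 x) \/ (exists y, z = h2 y)) ->
  (forall x x', f (h1 x) (h1 x') = f1 x x') ->
  (forall y y', f (h2 y) (h2 y') = f2 y y') ->
  (forall x y, f (h1 x) (h2 y) = 0) -> (forall x y, f (h2 y) (h1 x) = 0) ->
  \det (\matrix_(i < #|T|, j < #|T|) f (enum_val i) (enum_val j))
  = \det (\matrix_(i < #|T1|, j < #|T1|) f1 (enum_val i) (enum_val j))
    * \det (\matrix_(i < #|T2|, j < #|T2|) f2 (enum_val i) (enum_val j)).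
Proof.
move=> inj1 inj2 h12 onto f1E f2E f12 f21.
pose h (i : 'I_(#|T1| + #|T2|)) : T :=
  match fintype.split i with inl i1 => h1 (enum_val i1) | inr i2 => h2 (enum_val i2) end.
have h_bij : bijective h.
  have h_inj : injective h.
    move=> i j; rewrite /h -(fintype.splitK i) -(fintype.splitK j) !fintype.unsplitK.
    case: (fintype.split i) => x; case: (fintype.split j) => y.
    - by move=> /inj1/enum_val_inj ->.
    - by move=> E; have := h12 (enum_val x) (enum_val y); rewrite E eqxx.
    - by move=> E; have := h12 (enum_val y) (enum_val x); rewrite E eqxx.
    - by move=> /inj2/enum_val_inj ->.
  have h_onto z : exists i, h i = z.
    have [[x ->]|[y ->]] := onto z.
      exists (lshift _ (enum_rank x)); rewrite /h -[lshift _ _]/(unsplit (inl _)).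
      by rewrite fintype.unsplitK enum_rankK.
    exists (rshift _ (enum_rank y)); rewrite /h -[rshift _ _]/(unsplit (inr _)).
    by rewrite fintype.unsplitK enum_rankK.
  pose h' z := sval (cid (h_onto z)).
  have h'K z : h (h' z) = z := svalP (cid (h_onto z)).
  by exists h' => // i; apply: h_inj; rewrite h'K.
rewrite (@det_reindex _ _ _ f _ _ (enum_val_bij T) h_bij).
rewrite -(@det_ublock _ _ _ _ 0); congr (\det _); apply/matrixP => i j.
rewrite !mxE; case: split_ordP => i' ->; rewrite mxE; case: split_ordP => j' ->;
  rewrite !mxE /h -?[lshift _ _]/(unsplit (inl _)) -?[rshift _ _]/(unsplit (inr _))
    !fintype.unsplitK //.
Qed.

End FinDet.

Section ExplicitGlue.
Context (R : realType) (k : nat) (A : {set 'I_k}).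
Context (G1 : graph #|A|) (G2 : graph #|~: A|).

Definition mask_of (B : {set 'I_k}) : bitseq := [seq v \in B | v <- enum 'I_k].

Lemma enum_filter (B : {set 'I_k}) : enum B = [seq v <- enum 'I_k | v \in B].
Proof. by rewrite {2}/enum_mem filter_predT. Qed.

Lemma size_mask_of B : size (mask_of B) = k.
Proof. by rewrite size_map size_enum_ord. Qed.

Lemma count_mask_of B : count id (mask_of B) = #|B|.
Proof. by rewrite count_map cardE enum_filter size_filter; apply: eq_count. Qed.

Lemma mask_of_setC : map negb (mask_of A) = mask_of (~: A).
Proof. by rewrite -map_comp; apply: eq_map => v; rewrite /= inE. Qed.

(** Masks keep the order of the list and [enum_val] is increasing, so the two ways of numbering the
    vertices of a piece agree. *)
Lemma nth_mask_of (T : Type) (x : T) (B : {set 'I_k}) (s : seq T) (v : 'I_#|B|) :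
  size s = k -> nth x (mask (mask_of B) s) v = nth x s (enum_val v).
Proof.
move=> sk; have {1}-> : s = [seq nth x s (val i) | i <- enum 'I_k].
  rewrite -[LHS](mkseq_nth x) /mkseq sk -val_enum_ord -map_comp.
  by apply: eq_map.
rewrite -map_mask -filter_mask.
rewrite -enum_filter.
rewrite (nth_map (enum_val v)) -?cardE //; congr nth.
by rewrite -enum_val_nth.
Qed.

Lemma coord_mask (B : {set 'I_k}) (s : seq (plane R)) (w : vertex #|B|) :
  size s = k ->
  (xcoord (mask (mask_of B) s) w = xcoord s (embed_vertex w)) *
  (ycoord (mask (mask_of B) s) w = ycoord s (embed_vertex w)).
Proof. by move=> sk; case: w => [v|b] //=; rewrite nth_mask_of. Qed.

Lemma dcoord_embed (B : {set 'I_k}) (c : 'I_#|B| * bool) (w : vertex #|B|) :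
  (dxcoord R (embed_edge c) (embed_vertex w) = dxcoord R c w) *
  (dycoord R (embed_edge c) (embed_vertex w) = dycoord R c w).
Proof.
rewrite /dxcoord /dycoord.
by rewrite -[inl (embed_edge c).1]/(embed_vertex (inl c.1))
  (inj_eq (@embed_vertex_inj _ B)).
Qed.

Lemma dcoord_outside (B C : {set 'I_k}) (c : 'I_#|B| * bool) (w : vertex #|C|) :
  (forall v, v \in B -> v \notin C) ->
  (dxcoord R (embed_edge c) (embed_vertex w) = 0) *
  (dycoord R (embed_edge c) (embed_vertex w) = 0).
Proof.
move=> dBC; rewrite /dxcoord /dycoord.
suff /negbTE -> : embed_vertex w != inl (embed_edge c).1 by [].
case: w => [v|b] //; apply/negP => /eqP [E].
by have := dBC _ (enum_valP c.1); rewrite -E enum_valP.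
Qed.

Lemma darg0 (a b : R) : darg a b 0 0 = 0.
Proof. by rewrite /darg !mulr0 subrr mul0r. Qed.

(** Both ends of an edge lie in its own piece or at the fixed points L and R, so its angle is
    unchanged when a vertex of the other piece moves. *)
Lemma explicit_form_glue (s : seq (plane R)) : size s = k ->
  explicit_form (glue_graph G1 G2) s
  = explicit_form G1 (mask (mask_of A) s) * explicit_form G2 (mask (mask_of (~: A)) s).
Proof.
move=> sk; rewrite /explicit_form.
have dA v : v \in A -> v \notin ~: A by rewrite inE negbK.
have dA' v : v \in ~: A -> v \notin A by rewrite inE.
have embE (B : {set 'I_k}) (e : edge #|B|) :
  inl (embed_edge e).1 = embed_vertex (inl e.1) by [].
apply: (@det_sum_blocks _ _ _ _ (@embed_edge _ A) (@embed_edge _ (~: A))).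
- exact: embed_edge_inj.
- exact: embed_edge_inj.
- move=> e1 e2; apply/negP => /eqP [E _].
  by have := enum_valP e2.1; rewrite -E inE enum_valP.
- exact: edge_split.
- move=> e c; rewrite /explicit_dangle target_gluel embE.
  by rewrite !coord_mask // !dcoord_embed.
- move=> e c; rewrite /explicit_dangle target_gluer embE.
  by rewrite !coord_mask // !dcoord_embed.
- move=> e c; rewrite /explicit_dangle target_gluel embE.
  by rewrite !dcoord_outside // !subr0 addr0 !darg0 subrr.
- move=> e c; rewrite /explicit_dangle target_gluer embE.
  by rewrite !dcoord_outside // !subr0 addr0 !darg0 subrr.
Qed.

End ExplicitGlue.

(** * Weights as integrals over all tuples *)

Lemma measurable_invr (R : realType) : measurable_fun setT (fun x : R => x^-1).
Proof.
have -> : [set: R] = [set 0] `|` ~` [set 0] by rewrite setUCr.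
have m0 : measurable ([set 0] : set R) by exact: measurable_set1.
apply/measurable_funU => //; first exact: measurableC.
split; first exact: measurable_fun_set1.
apply: open_continuous_measurable_fun.
  by apply: closed_openC; exact/accessible_closed_set1/hausdorff_accessible/Rhausdorff.
by move=> x; rewrite inE => /eqP x0; exact: inv_continuous.
Qed.

Lemma measurable_det (R : realType) d (T : measurableType d) (n : nat)
    (M : T -> 'M[R]_n) :
  (forall i j, measurable_fun setT (fun z => M z i j)) ->
  measurable_fun setT (fun z => \det (M z)).
Proof.
move=> mM; rewrite /determinant; apply: measurable_sum => s.
apply: measurable_funM; first exact: measurable_cst.
by apply: measurable_prod => i _; exact: mM.
Qed.

Section PlaneMeasure.
Context (R : realType).

Lemma plane_lebesgue_sigma_finite : sigma_finite setT (@plane_lebesgue R).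
Proof. exact: sigma_finite_product. Qed.

(** Convertible to [plane_lebesgue], with its sigma-finite structure attached. *)
Definition plane_measure : {sigma_finite_measure set (plane R) -> \bar R} :=
  @with_sigma_finite _ (plane R) R
    (@lebesgue_measure R \x @lebesgue_measure R)%E plane_lebesgue_sigma_finite.

Lemma measurable_plane_set1 (x : plane R) : measurable [set x].
Proof.
have -> : [set x] = [set x.1] `*` [set x.2].
  apply/seteqP; split=> y /= => [->//|[y1 y2]].
  by rewrite (surjective_pairing y) y1 y2 -surjective_pairing.
by apply: measurableX; exact: measurable_set1.
Qed.

Lemma plane_measure_set1 (x : plane R) : plane_measure [set x] = 0%E.
Proof.
have -> : [set x] = [set x.1] `*` [set x.2].
  apply/seteqP; split=> y /= => [->//|[y1 y2]].
  by rewrite (surjective_pairing y) y1 y2 -surjective_pairing.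
rewrite [LHS]product_measure1E; [|exact: measurable_set1|exact: measurable_set1].
by rewrite [X in (X * _)%E](_ : _ = 0%E) ?mul0e //; exact: lebesgue_measure_set1.
Qed.

End PlaneMeasure.

Section WeightIntegrand.
Context (R : realType).

(** Lying in the half plane is a condition on each point, hence a product that splits over pieces.
    Distinctness of the points does not split, and is left out. *)
Definition weight_integrand (k : nat) (G : graph k) (s : seq (plane R)) : R :=
  explicit_form G s * \prod_(p <- s) (0 < p.2 :> R)%:R.

Definition weight_const (k : nat) : R := (2 ^+ k * (2 * pi) ^+ (2 * k))^-1.

Lemma measurable_coord k (w : vertex k) :
  measurable_fun setT (fun z : k.-tuple (plane R) => xcoord z w : R) /\
  measurable_fun setT (fun z : k.-tuple (plane R) => ycoord z w : R).
Proof.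
case: w => [v|b] /=; last by split.
split.
- have -> : (fun z : k.-tuple (plane R) => (nth (0, 0) z v).1 : R)
      = fst \o (@tnth k (plane R) ^~ v).
    by apply/funext => z /=; rewrite (tnth_nth (0, 0)).
  by apply: measurableT_comp => //; exact: measurable_tnth.
- have -> : (fun z : k.-tuple (plane R) => (nth (0, 0) z v).2 : R)
      = snd \o (@tnth k (plane R) ^~ v).
    by apply/funext => z /=; rewrite (tnth_nth (0, 0)).
  by apply: measurableT_comp => //; exact: measurable_tnth.
Qed.

Lemma measurable_darg d (T : measurableType d) (a b : T -> R) (da db : R) :
  measurable_fun setT a -> measurable_fun setT b ->
  measurable_fun setT (fun z => darg (a z) (b z) da db).
Proof.
move=> ma mb; rewrite /darg; apply: measurable_funM.
  by apply: measurable_funB; apply: measurable_funM.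
apply: (measurableT_comp (@measurable_invr R)).
by apply: measurable_funD; apply: measurable_funX.
Qed.

Lemma measurable_weight_integrand k (G : graph k) :
  measurable_fun setT (fun z : k.-tuple (plane R) => weight_integrand G z).
Proof.
apply: measurable_funM.
  apply: measurable_det => i j; under eq_fun do rewrite mxE.
  have [mxw myw] := measurable_coord (target G (enum_val i)).
  have [mxv myv] := measurable_coord (inl (enum_val i).1 : vertex k).
  rewrite /explicit_dangle; apply: measurable_funB; apply: measurable_darg;
    by [exact: measurable_funB|exact: measurable_funD].
under eq_fun do rewrite big_tuple.
apply: measurable_prod => v _.
have -> : (fun z : k.-tuple (plane R) => (0 < (tnth z v).2 :> R)%:R : R)
    = \1_(`]0, +oo[) \o (snd \o (@tnth k (plane R) ^~ v)).
  by apply/funext => z; rewrite /= indicE mem_setE in_itv /= andbT.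
apply: measurableT_comp; first exact: measurable_indic.
by apply: measurableT_comp => //; exact: measurable_tnth.
Qed.

Lemma measurable_diagonal k (v w : 'I_k) :
  measurable [set z : k.-tuple (plane R) | tnth z v = tnth z w].
Proof.
have mx (u : 'I_k) : measurable_fun setT (fun z : k.-tuple (plane R) => (tnth z u).1 : R).
  by apply: measurableT_comp => //; exact: measurable_tnth.
have my (u : 'I_k) : measurable_fun setT (fun z : k.-tuple (plane R) => (tnth z u).2 : R).
  by apply: measurableT_comp => //; exact: measurable_tnth.
have -> : [set z : k.-tuple (plane R) | tnth z v = tnth z w]
    = ((fun z => (tnth z v).1 - (tnth z w).1 : R) @^-1` [set 0])
      `&` ((fun z => (tnth z v).2 - (tnth z w).2 : R) @^-1` [set 0]).
  apply/seteqP; split=> z /=; first by move=> ->; rewrite !subrr.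
  move=> [/eqP + /eqP]; rewrite !subr_eq0 => /eqP z1 /eqP z2.
  by rewrite (surjective_pairing (tnth z v)) z1 z2 -surjective_pairing.
apply: measurableI; rewrite -[X in measurable X]setTI;
  by apply: measurable_funB => //; exact: measurable_set1.
Qed.

End WeightIntegrand.

Section Weights.
Context (R : realType).
Local Notation power k := (power_measure (n := k) (plane_measure R)).

Definition collisions (k : nat) : set (k.-tuple (plane R)) :=
  \big[setU/set0]_(p : 'I_k * 'I_k | p.1 != p.2)
    [set z | tnth z p.1 = tnth z p.2].

Lemma collisionsP k (z : k.-tuple (plane R)) :
  @collisions k z <-> exists v w : 'I_k, v != w /\ tnth z v = tnth z w.
Proof.
rewrite /collisions -bigcup_seq_cond; split=> [[[v w] /= /andP[_ vw] zvw]|].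
  by exists v, w.
by move=> [v [w [vw zvw]]]; exists (v, w) => //=; rewrite mem_index_enum.
Qed.

Lemma collisions_null k : measurable (@collisions k) /\ power k (@collisions k) = 0%E.
Proof.
have [nu nuE] := power_measure_sigma_finite (plane_measure R) k; rewrite nuE.
rewrite /collisions; apply: (big_ind (fun A => measurable A /\ nu A = 0%E)).
- by split; [exact: measurable0|exact: measure0].
- by move=> A B [mA A0] [mB B0]; split; [exact: measurableU|rewrite measureU0].
- move=> [v w] /= vw; split; first exact: measurable_diagonal.
  rewrite -nuE power_diagonal //; first exact: plane_measure_set1.
  exact: measurable_plane_set1.
Qed.

(** [angle_form] is known only on configurations, but off them the restricted integrand is 0. It
    thus agrees with [weight_integrand] away from the collisions. *)
Lemma weightE k (G : graph k) :
  weight R G = weight_const R k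
    * fine (\int[power k]_z (weight_integrand G z)%:E)%E.
Proof.
rewrite /weight -/(weight_const R k); congr (_ * fine _).
rewrite -[power_measure _ (n := k)]/(power k).
have [mN N0] := collisions_null k.
have [nu nuE] := power_measure_sigma_finite (plane_measure R) k.
rewrite nuE in N0 *; rewrite integral_mkcond.
have mW := @measurable_weight_integrand R k G.
have confP z : half_plane_conf z <->
    (\prod_(p <- z) (0 < p.2 :> R)%:R = 1 :> R /\ ~ @collisions k z).
  split=> [[z0 zn]|[z1 zN]].
    split; first by rewrite big_tuple big1 // => v _; rewrite z0.
    by move/collisionsP => [v [w [vw]]]; exact: zn.
  split=> [v|v w vw zvw]; last by apply: zN; apply/collisionsP; exists v, w.
  apply/negPn/negP => /negbTE zv; move: z1.
  by rewrite big_tuple (bigD1 v) //= zv mul0r => /esym/eqP; rewrite oner_eq0.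
have posE (z : k.-tuple (plane R)) : ~ @collisions k z -> ~ half_plane_conf z ->
    \prod_(p <- z) (0 < p.2 :> R)%:R = 0 :> R.
  move=> zN zc; apply/eqP/negPn/negP => p0; apply: zc; apply/confP; split=> //.
  rewrite big_tuple big1 // => v _; case: ltP => // zv; move: p0.
  by rewrite big_tuple (bigD1 v) //= ltNge zv mul0r eqxx.
have patchE : (fun z => (angle_form G z)%:E) \_ (@half_plane_conf R k)
    = (fun z : k.-tuple (plane R) => (weight_integrand G z * \1_(~` @collisions k) z)%:E).
  apply/funext => z; rewrite patchE indicE; case: ifPn => [|/negP].
    rewrite inE => zc; have /confP[z1 zN] := zc.
    by rewrite mem_set // mulr1 /weight_integrand z1 mulr1 angle_formE.
  rewrite inE => zc; have [zN|zN] := pselect (@collisions k z).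
    by rewrite memNset ?mulr0 //; apply.
  by rewrite /weight_integrand posE // mulr0 mul0r.
rewrite patchE; apply: ae_eq_integral => //.
- apply/measurable_EFinP; apply: measurable_funM => //.
  by apply: measurable_indic; exact: measurableC.
- exact/measurable_EFinP.
- exists (@collisions k); split=> // z /= zne.
  apply: contrapT => zN; apply: zne => _.
  by rewrite indicE mem_set // mulr1.
Qed.

Lemma weight_constD j k : weight_const R (j + k) = weight_const R j * weight_const R k.
Proof.
by rewrite /weight_const -invfM; congr (_^-1); rewrite mulnDr !exprD mulrACA.
Qed.

Lemma weight_graph0 (G : graph 0) : weight R G = 1.
Proof.
rewrite weightE /weight_const muln0 !expr0 mulr1 invr1 mul1r.
rewrite /= integral_dirac //=; last first.
  by apply/measurable_EFinP; exact: measurable_weight_integrand.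
rewrite indicE in_setT mul1r /weight_integrand big_nil mulr1.
have det0 n (M : 'M[R]_n) : n = 0%N -> \det M = 1.
  by move=> n0; subst n; exact: det_mx00.
by apply: det0; rewrite card_prod card_ord.
Qed.

Lemma prod_mask (bm : bitseq) (s : seq (plane R)) (f : plane R -> R) :
  size bm = size s ->
  \prod_(p <- s) f p
  = \prod_(p <- mask bm s) f p * \prod_(p <- mask (map negb bm) s) f p.
Proof.
elim: bm s => [|b bm IHbm] [|p s] //=; first by rewrite !big_nil mulr1.
move=> [/IHbm E]; case: b; rewrite /= !big_cons E; first by rewrite mulrA.
by rewrite mulrCA.
Qed.

Lemma weight_glue : glue_multiplicative (@weight R).
Proof.
move=> k A G1 G2; rewrite !weightE mulrACA -weight_constD.
have -> : (#|A| + #|~: A| = k)%N by rewrite cardsC card_ord.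
congr (_ * _).
have H := @fine_integral_power_shuffle _ _ R (plane_measure R) (mask_of A)
  (weight_integrand G1) (weight_integrand G2).
(* The integrands take lists, so the tuple lengths can be rewritten without casts. *)
rewrite -count_negb mask_of_setC !count_mask_of size_mask_of in H.
rewrite -H; [|exact: measurable_weight_integrand..].
congr fine; have [nu ->] := power_measure_sigma_finite (plane_measure R) k.
apply: eq_integral => z _; rewrite /weight_integrand.
rewrite explicit_form_glue ?size_tuple // -mask_of_setC.
rewrite (@prod_mask (mask_of A)) ?size_mask_of ?size_tuple //.
by rewrite mulrACA mask_of_setC.
Qed.

End Weights.

(** * Graphs without an edge to L or to R *)

Section Vanishing.
Context (R : realType) (k : nat) (G : graph k).

(* Coordinates of the vector field generating the dilations centered at L (for
   [b = true]) or at R (for [b = false]). *)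
Definition dilation (b : bool) (s : seq (plane R)) (c : 'I_k * bool) : R :=
  if c.2 then ycoord s (inl c.1 : vertex k)
  else xcoord s (inl c.1 : vertex k) - (~~ b)%:R.

(** At the centre both sides are 0. The first equation fails at [inr b], which stays in place
    although the dilation would move it. *)
Lemma sum_dxcoord_dilation b s (w : vertex k) : w != inr b ->
  (\sum_c dxcoord R c w * dilation b s c = xcoord s w - (~~ b)%:R) *
  (\sum_c dycoord R c w * dilation b s c = ycoord s w).
Proof.
case: w => [v|b'] wb; last first.
  have -> : b' = ~~ b by case: b' b wb => -[].
  rewrite /= subrr; split; apply: big1 => c _;
    by rewrite /dxcoord /dycoord mul0r.
split.
  rewrite (bigD1 (v, false)) //= big1 ?addr0 => [|c].
    by rewrite /dxcoord eqxx mul1r.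
  case: c => u []; rewrite /dxcoord ?andbF ?mul0r // xpair_eqE eqxx andbT => uv.
  rewrite (_ : (_ == _) = false) ?mul0r //.
  by apply/eqP => -[]; apply/eqP; rewrite eq_sym.
rewrite (bigD1 (v, true)) //= big1 ?addr0 => [|c].
  by rewrite /dycoord eqxx mul1r.
case: c => u []; rewrite /dycoord ?andbF ?mul0r // xpair_eqE eqxx andbT => uv.
rewrite (_ : (_ == _) = false) ?mul0r //.
by apply/eqP => -[]; apply/eqP; rewrite eq_sym.
Qed.

(** The dilation rescales numerator and denominator of the ratio: each moves in the direction
    [(a, b)] of its own value, along which [darg] vanishes. *)
Lemma explicit_dangle_dilation b (s : seq (plane R)) (e : edge k) :
  target G e != inr b ->
  \sum_c explicit_dangle G s e c * dilation b s c = 0.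
Proof.
move=> eb; set v : vertex k := inl e.1; set w := target G e.
have vb : v != inr b by [].
transitivity (darg (xcoord s w - xcoord s v) (ycoord s w - ycoord s v)
    (\sum_c (dxcoord R c w - dxcoord R c v) * dilation b s c)
    (\sum_c (dycoord R c w - dycoord R c v) * dilation b s c)
  - darg (xcoord s w - xcoord s v) (ycoord s w + ycoord s v)
    (\sum_c (dxcoord R c w - dxcoord R c v) * dilation b s c)
    (\sum_c (dycoord R c w + dycoord R c v) * dilation b s c)).
  rewrite /darg !mulr_sumr -!sumrB !mulr_suml -sumrB; apply: eq_bigr => c _.
  by rewrite /explicit_dangle /darg -/v -/w; ring.
under [X in darg _ _ X _ - _]eq_bigr do rewrite mulrBl.
under [X in darg _ _ _ X - _]eq_bigr do rewrite mulrBl.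
under [X in _ - darg _ _ X _]eq_bigr do rewrite mulrBl.
under [X in _ - darg _ _ _ X]eq_bigr do rewrite mulrDl.
rewrite !sumrB big_split /= !(sum_dxcoord_dilation s eb) !(sum_dxcoord_dilation s vb).
rewrite /darg opprB addrA subrK ![(ycoord _ _ - _) * _]mulrC subrr mul0r.
by rewrite ![(ycoord _ _ + _) * _]mulrC subrr mul0r subrr.
Qed.

Lemma weight_eq0 (b : bool) : (0 < k)%N -> (forall e, target G e != inr b) ->
  weight R G = 0.
Proof.
move=> k0 Gb; rewrite weightE.
have [nu ->] := power_measure_sigma_finite (plane_measure R) k.
rewrite (_ : (\int[nu]_z _)%E = 0%E) ?mulr0 //.
rewrite -[RHS](integral0 nu setT); apply: eq_integral => z _.
congr EFin; rewrite /weight_integrand.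
have [->|] := eqVneq (\prod_(p <- z) (0 < p.2 :> R)%:R : R) 0; first by rewrite mulr0.
move=> z0; suff -> : explicit_form G z = 0 by rewrite mul0r.
pose M := \matrix_(i < #|{: 'I_k * bool}|, j < #|{: 'I_k * bool}|)
  explicit_dangle G z (enum_val i) (enum_val j).
pose u : 'rV[R]_#|{: 'I_k * bool}| := \row_j dilation b z (enum_val j).
(* [det0P] asks for a left kernel vector, hence the transpose. The vector is nonzero because its
   ordinate entries are the heights of the points, and a zero height would annihilate the indicator
   product. *)
rewrite /explicit_form -/M -det_tr; apply/eqP/det0P; exists u.
  apply: contra_neq z0 => u0; pose v0 : 'I_k := Ordinal k0.
  rewrite big_tuple (bigD1 v0) //=.
  have := congr1 (fun A : 'rV_ _ => A 0 (enum_rank (v0, true))) u0.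
  rewrite !mxE enum_rankK /dilation /= => y0.
  by rewrite (tnth_nth (0, 0)) /= y0 ltxx mul0r.
apply/rowP => i; rewrite !mxE.
transitivity (\sum_c explicit_dangle G z (enum_val i) c * dilation b z c).
  rewrite [RHS](reindex _ (onW_bij _ (enum_val_bij _))) /=.
  by apply: eq_bigr => j _; rewrite !mxE mulrC.
exact: explicit_dangle_dilation.
Qed.

End Vanishing.

Local Close Scope classical_set_scope.

(** * Multi-symmetric functions *)

Section Multisym.
Context (A : comNzRingType) (S : choiceType).
Implicit Types (d : {fsfun S -> nat with 0%N}).

Lemma expo_varE (s x : S) : expo_var s x = (x == s).
Proof. by rewrite /expo_var fsfunE inE; case: eqP. Qed.

Definition expo_sub d (s : S) : {fsfun S -> nat with 0%N} :=
  [fsfun x in finsupp d => (d x - (x == s))%N | 0%N].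

Lemma expo_subE d (s x : S) : expo_sub d s x = (d x - (x == s))%N.
Proof.
rewrite fsfunE; case: ifPn => //; rewrite mem_finsupp negbK => /eqP ->.
by rewrite sub0n.
Qed.

Lemma finsupp_expo_var (s : S) : finsupp (expo_var s) = [fset s]%fset.
Proof. by apply/fsetP => x; rewrite mem_finsupp expo_varE inE; case: (x == s). Qed.

Lemma expo_var_inj : injective (@expo_var S).
Proof.
by move=> s s' /fsfunP/(_ s); rewrite !expo_varE eqxx; case: eqP.
Qed.

Lemma tlinear_var (u : S -> A) (s : S) : tlinear u (expo_var s) = u s.
Proof.
by rewrite /tlinear finsupp_expo_var big_mkcond big_seq_fset1 eqxx.
Qed.

Lemma tlinear_other (u : S -> A) d :
  (forall s, d != expo_var s) -> tlinear u d = 0.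
Proof. by move=> ds; rewrite /tlinear big1 // => s; rewrite (negbTE (ds s)). Qed.

Lemma tone_var (s : S) : @tone A S (expo_var s) = 0.
Proof.
rewrite /tone finsupp_expo_var; case: eqP => // /fsetP/(_ s).
by rewrite !inE eqxx.
Qed.

Lemma tone0 : @tone A S [fsfun] = 1.
Proof. by rewrite /tone finsupp0 eqxx. Qed.

Lemma tone_other d : d != [fsfun] -> @tone A S d = 0.
Proof.
move=> d0; rewrite /tone; case: eqP => // ds; case/eqP: d0.
by apply/fsfunP => x; rewrite fsfunE; apply: fsfun_dflt; rewrite ds inE.
Qed.

(** * Expansion of the generating product over colourings *)

Section Colorings.
Context (S' : finType) (emb : S' -> S) (emb_inj : injective emb).

(** The first factor is supported at 0 and at the single variables, so the only decompositions of
    [d] that matter are those listed in [r]. *)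
Lemma tmul_linear (u : S -> A) (H : tseries A S) d :
  (forall s, s \in finsupp d -> exists s', s = emb s') ->
  tmul (fun eps => @tone A S eps + tlinear u eps) H d
  = H d + \sum_(s' : S' | (0 < d (emb s'))%N) u (emb s') * H (expo_sub d (emb s')).
Proof.
move=> dS'.
pose r := ([fsfun], d) ::
  [seq (expo_var (emb s'), expo_sub d (emb s')) | s' <- enum S'
                                                & (0 < d (emb s'))%N].
have var_neq0 (s : S) : expo_var s != [fsfun] :> {fsfun S -> nat with 0%N}.
  by apply/eqP => /fsfunP/(_ s); rewrite expo_varE eqxx fsfunE.
have inj_r : injective (fun s' => (expo_var (emb s'), expo_sub d (emb s'))).
  by move=> s' t' [/expo_var_inj/emb_inj].
rewrite /tmul (fsbigE r).
- rewrite big_mkcond /r big_cons /= big_map big_filter big_enum_cond /=.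
  rewrite mem_set; last by move=> s /=; rewrite fsfunE.
  rewrite tone0 tlinear_other => [|s]; last by rewrite eq_sym var_neq0.
  rewrite addr0 mul1r; congr (_ + _); apply: eq_bigr => s' ds'.
  rewrite mem_set; first by rewrite tone_var add0r tlinear_var.
  move=> s /=; rewrite expo_varE expo_subE subnKC //.
  by case: eqP => // ->.
- rewrite /r /= (map_inj_uniq inj_r) filter_uniq ?enum_uniq // andbT.
  apply/mapP => -[s' _ [E _]].
  by have := var_neq0 (emb s'); rewrite -E eqxx.
- move=> [x y] /=; rewrite inE => /orP[/eqP[-> ->] s|/mapP[s']].
    by rewrite fsfunE.
  rewrite mem_filter => /andP[ds' _] [-> ->] s.
  rewrite expo_varE expo_subE subnKC //.
  by case: eqP => // ->.
- move=> [x y] /= xy; rewrite inE negb_or => /andP[nxy xr].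
  have [x0|x0] := eqVneq x [fsfun].
    case/eqP: nxy; rewrite x0; congr (_, _); apply/fsfunP => s.
    by rewrite -xy x0 fsfunE.
  rewrite (tone_other x0). rewrite add0r. suff -> : tlinear u x = 0 by rewrite mul0r.
  apply: tlinear_other => s.
  apply/eqP => xs; have ds : s \in finsupp d.
    by rewrite mem_finsupp -xy xs expo_varE eqxx.
  have [s' ss'] := dS' _ ds; case/negP: xr; apply/mapP; exists s'.
    rewrite mem_filter mem_enum andbT /= -ss'.
    by rewrite -xy xs expo_varE eqxx.
  rewrite -ss' xs; congr (_, _); apply/fsfunP => t.
  by rewrite expo_subE -xy xs expo_varE addKn.
Qed.

Definition color_count n (c : {ffun 'I_n -> option S'}) s' :=
  #|[set i | c i == Some s']|.

Definition ffun_cons n (o : option S') (c : {ffun 'I_n -> option S'}) :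
    {ffun 'I_n.+1 -> option S'} :=
  [ffun i => if unlift ord0 i is Some j then c j else o].

Lemma color_count_cons n o (c : {ffun 'I_n -> option S'}) s' :
  color_count (ffun_cons o c) s' = ((o == Some s') + color_count c s')%N.
Proof.
rewrite /color_count -!sum1_card big_mkcond big_ord_recl /=.
rewrite inE ffunE unlift_none; congr (_ + _)%N.
rewrite [RHS]big_mkcond; apply: eq_bigr => i _.
by rewrite !inE ffunE liftK.
Qed.

(** Each factor contributes 1, recorded as [None], or one term [u_s t_s]. As [S] may be infinite,
    colours are drawn from a finite [S'] that covers the support of [d]. *)
Lemma tseries_prodE n (u : 'I_n -> S -> A) d :
  (forall s, s \in finsupp d -> exists s', s = emb s') ->
  (\big[@tmul A S/@tone A S]_(i < n) (fun eps => @tone A S eps + tlinear (u i) eps)) d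
  = \sum_(c : {ffun 'I_n -> option S'} | [forall s', color_count c s' == d (emb s')])
      \prod_(i < n) oapp (u i \o emb) 1 (c i).
Proof.
elim: n u d => [|n IHn] u d dS'.
  rewrite big_ord0 /tone; case: eqP => d0.
    rewrite (big_pred1 [ffun => None]) ?big_ord0 // => c.
    apply/forallP/eqP => [_|_ s']; first by apply/ffunP => -[].
    rewrite /color_count (_ : [set _ | _] = finset.set0) ?cards0; last first.
      by apply/setP => -[].
    by rewrite eq_sym; apply/eqP/fsfun_dflt; rewrite d0 inE.
  rewrite big_pred0 // => c; apply/negP => /forallP c_d; case: d0.
  apply/fsetP => s; rewrite [RHS]inE; apply/negP => ds.
  have [s' ss'] := dS' s ds; have := c_d s'.
  rewrite /color_count (_ : [set _ | _] = finset.set0) ?cards0; last first.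
    by apply/setP => -[].
  by rewrite -ss'; move: ds; rewrite mem_finsupp eq_sym => /negbTE ->.
rewrite big_ord_recl tmul_linear // IHn //.
pose split (c : {ffun 'I_n.+1 -> option S'}) : option S' * {ffun 'I_n -> option S'} :=
  (c ord0, [ffun j => c (lift ord0 j)]).
rewrite [RHS](reindex (fun x => ffun_cons x.1 x.2)) /=; last first.
  exists split; first move=> [x c] _ /=.
    rewrite /split /ffun_cons ffunE unlift_none; congr (_, _).
    by apply/ffunP => j; rewrite !ffunE liftK.
  move=> c _; apply/ffunP => i; rewrite ffunE; case: unliftP => [j ->|-> //].
  by rewrite ffunE.
rewrite (eq_bigl (fun x => xpredT x.1 &&
    [forall s', ((x.1 == Some s') + color_count x.2 s')%N == d (emb s')]));
  last first.
  by move=> x; apply: eq_forallb => s'; rewrite color_count_cons.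
rewrite -(pair_big_dep xpredT
  (fun o c => [forall s', ((o == Some s') + color_count c s')%N == d (emb s')])
  (fun o c => \prod_(i < n.+1) oapp (u i \o emb) 1 (ffun_cons o c i))) /=.
have prodE o c : \prod_(i < n.+1) oapp (u i \o emb) 1 (ffun_cons o c i)
    = oapp (u ord0 \o emb) 1 o * \prod_(i < n) oapp (u (lift ord0 i) \o emb) 1 (c i).
  rewrite big_ord_recl ffunE unlift_none; congr (_ * _).
  by apply: eq_bigr => i _; rewrite ffunE liftK.
rewrite (bigD1 None) //=; congr (_ + _).
  by apply: eq_bigr => c _; rewrite prodE mul1r.
rewrite big_mkcond [RHS](reindex_omap Some id) => [|[]] //=.
rewrite [RHS]big_mkcond /=; apply: eq_bigr => s' _; rewrite eqxx /=.
case: ifPn => [ds'|]; last first.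
  rewrite -eqn0Ngt => /eqP ds'; rewrite big_pred0 // => c.
  by apply/negP => /forallP/(_ s'); rewrite eqxx ds'.
rewrite IHn; last first.
  move=> s; rewrite mem_finsupp expo_subE => sd; apply: dS'.
  by rewrite mem_finsupp; apply: contraNneq sd => ->.
rewrite mulr_sumr; apply: eq_big => [c|c _]; last by rewrite prodE.
apply: eq_forallb => t'; rewrite expo_subE (inj_eq emb_inj).
have -> : (Some s' == Some t') = (t' == s') by rewrite eq_sym.
have [->|_] := eqVneq t' s'; last by rewrite add0n subn0.
by rewrite -[LHS](eqn_add2l true) subnKC.
Qed.

End Colorings.
End Multisym.

Lemma multisymE (R : realType) (n d : nat) (S : choiceType) (S' : finType)
    (emb : S' -> S) (u : S -> mpoly d R) (delta : expo S) :
  injective emb ->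
  (forall s, s \in finsupp delta -> exists s', s = emb s') ->
  multisym n u delta
  = \sum_(c : {ffun 'I_n -> option S'} |
           [forall s', color_count c s' == delta (emb s')])
      \prod_(i < n) at_point i (oapp (u \o emb) 1 (c i)).
Proof.
move=> emb_inj dS'.
rewrite /multisym (@tseries_prodE _ _ _ emb emb_inj n (fun i s => at_point i (u s))) //.
apply: eq_bigr => c _; apply: eq_bigr => i _.
by case: (c i) => [s|] //=; rewrite at_point1.
Qed.

(** * Invariance under permutations of the points *)

Section PermPoints.
Context (R : realType) (n d : nat).

Lemma perm_points_at_point (s : 'S_n) (i : 'I_n) (f : mpoly d R) :
  perm_points s (at_point i f) = at_point (s i) f.
Proof.
elim/mpoly_generators_ind: f => [c|j|f g IHf IHg|f g IHf IHg].
- by rewrite !at_pointC /perm_points comp_mpolyC.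
- rewrite !at_pointX /perm_points /xvar comp_mpolyXU -tnth_nth tnth_mktuple.
  by rewrite enum_rankK.
- by rewrite !at_pointD -IHf -IHg /perm_points comp_mpolyD.
- by rewrite !at_pointM -IHf -IHg /perm_points rmorphM.
Qed.

(** Permuting the points permutes the colourings and preserves the number of uses of each colour. *)
Lemma perm_points_multisym (S : finType) (s : 'S_n) (u : S -> mpoly d R)
    (delta : expo S) :
  perm_points s (multisym n u delta) = multisym n u delta.
Proof.
have E := @multisymE R n d S S id u delta (@inj_id _) (fun x _ => ex_intro _ x erefl).
rewrite {1}E {}E [in LHS]/perm_points raddf_sum /=.
pose h (c : {ffun 'I_n -> option S}) : {ffun 'I_n -> option S} :=
  [ffun i => c (s^-1%g i)].
pose h' (c : {ffun 'I_n -> option S}) : {ffun 'I_n -> option S} :=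
  [ffun i => c (s i)].
have hK c : h' (h c) = c by apply/ffunP => i; rewrite !ffunE permK.
have h'K c : h (h' c) = c by apply/ffunP => i; rewrite !ffunE permKV.
rewrite [RHS](reindex h) /=; last by exists h' => c _; rewrite ?hK ?h'K.
apply: eq_big => [c|c _].
  apply: eq_forallb => x; congr (_ == _); rewrite /color_count.
  rewrite -(card_imset _ (@perm_inj _ s)); apply: eq_card => i.
  rewrite inE ffunE; apply/imsetP/idP => [[j]|ci].
    by rewrite inE => cj ->; rewrite permK.
  by exists (s^-1%g i); rewrite ?inE // permKV.
rewrite rmorph_prod /= [RHS](reindex_inj (@perm_inj _ s)) /=.
apply: eq_bigr => i _; rewrite -/(perm_points s _) perm_points_at_point.
by rewrite ffunE permK.
Qed.

Lemma quantum_symmetric_hconst (f : mpoly (ncoord n d) R) :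
  (forall s, perm_points s f = f) -> @quantum_symmetric R n d (hconst f).
Proof.
move=> fs s m; rewrite /hconst; case: eqP => // _.
exact: comp_mpoly0.
Qed.

End PermPoints.

(** * Bilinearity and the unit *)

Section Bidiff.
Context (R : realType) (N : nat) (pi : 'I_N -> 'I_N -> mpoly N R).
Implicit Types f g h : mpoly N R.

Lemma deriv_atD k (G : graph k) (J : {ffun edge k -> 'I_N}) v f g :
  deriv_at G J v (f + g) = deriv_at G J v f + deriv_at G J v g.
Proof. by rewrite !deriv_atE derivsD. Qed.

Lemma deriv_at0 k (G : graph k) (J : {ffun edge k -> 'I_N}) v :
  deriv_at G J v (0 : mpoly N R) = 0.
Proof. by rewrite deriv_atE derivs0. Qed.

Lemma star_coefDl k f g h :
  star_coef pi k (f + g) h = star_coef pi k f h + star_coef pi k g h.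
Proof.
rewrite /star_coef -big_split /=; apply: eq_bigr => G _.
rewrite -scalerDr; congr (_ *: _); rewrite /bidiff -big_split /=.
by apply: eq_bigr => J _; rewrite deriv_atD mulrDr mulrDl.
Qed.

Lemma star_coefDr k f g h :
  star_coef pi k h (f + g) = star_coef pi k h f + star_coef pi k h g.
Proof.
rewrite /star_coef -big_split /=; apply: eq_bigr => G _.
rewrite -scalerDr; congr (_ *: _); rewrite /bidiff -big_split /=.
by apply: eq_bigr => J _; rewrite deriv_atD mulrDr.
Qed.

Lemma star_coef0l k h : star_coef pi k 0 h = 0.
Proof.
rewrite /star_coef big1 // => G _; rewrite /bidiff big1 ?scaler0 // => J _.
by rewrite deriv_at0 mulr0 mul0r.
Qed.

Lemma star_coef0r k h : star_coef pi k h 0 = 0.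
Proof.
rewrite /star_coef big1 // => G _; rewrite /bidiff big1 ?scaler0 // => J _.
by rewrite deriv_at0 mulr0.
Qed.

Lemma star_coef_sum k (I J : Type) (r : seq I) (s : seq J) (P : pred I) (Q : pred J)
    (F : I -> mpoly N R) (H : J -> mpoly N R) :
  star_coef pi k (\sum_(i <- r | P i) F i) (\sum_(j <- s | Q j) H j)
  = \sum_(i <- r | P i) \sum_(j <- s | Q j) star_coef pi k (F i) (H j).
Proof.
rewrite (big_morph (fun f => star_coef pi k f _)
  (fun f g => star_coefDl k f g _) (star_coef0l k _)).
apply: eq_bigr => i _.
exact: (big_morph (star_coef pi k (F i))
  (fun f g => star_coefDr k f g _) (star_coef0r k _)).
Qed.

Lemma star_hconst f g m : star pi (hconst f) (hconst g) m = star_coef pi m f g.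
Proof.
rewrite /star (bigD1 ord0) //= [X in _ + X]big1 ?addr0 => [|i i0]; last first.
  rewrite big1 // => j _; rewrite big1 // => k _.
  by rewrite /hconst -val_eqE /= in i0 *; rewrite (negbTE i0) star_coef0l.
rewrite (bigD1 ord0) //= [X in _ + X]big1 ?addr0 => [|j j0]; last first.
  by rewrite big1 // => k _; rewrite /hconst -val_eqE /= in j0 *;
    rewrite (negbTE j0) star_coef0r.
by rewrite (big_pred1 ord_max) // => k; rewrite !add0n -val_eqE.
Qed.

Lemma bidiff0 (G : graph 0) f g : bidiff pi G f g = f * g.
Proof.
have E0 : enum (edge 0) = [::].
  by apply: size0nil; rewrite -cardE card_prod card_ord.
rewrite /bidiff; have J0 : {ffun edge 0 -> 'I_N} by apply: finfun => -[[]].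
rewrite (big_pred1 J0) => [|J]; last first.
  by apply/esym/eqP/ffunP => -[[]].
by rewrite big_ord0 mul1r !deriv_atE E0.
Qed.

Lemma deriv_at1 k (G : graph k) (J : {ffun edge k -> 'I_N}) e :
  deriv_at G J (target G e) (1 : mpoly N R) = 0.
Proof.
rewrite (@deriv_at_outside _ _ _ _ _ finset.set0) //; last by rewrite inE.
exact: depends_on1.
Qed.

Lemma weight_bidiff1r k (G : graph k) f : (0 < k)%N ->
  weight R G *: bidiff pi G f 1 = 0.
Proof.
move=> k0.
have [/existsP[e /eqP eR]|/existsPn noR] := boolP [exists e, target G e == vR k].
  rewrite /bidiff big1 ?scaler0 // => J _.
  by rewrite -eR deriv_at1 mulr0.
by rewrite (@weight_eq0 _ _ G true) // scale0r.
Qed.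

Lemma weight_bidiff1l k (G : graph k) g : (0 < k)%N ->
  weight R G *: bidiff pi G 1 g = 0.
Proof.
move=> k0.
have [/existsP[e /eqP eL]|/existsPn noL] := boolP [exists e, target G e == vL k].
  rewrite /bidiff big1 ?scaler0 // => J _.
  by rewrite -eL deriv_at1 mulr0 mul0r.
by rewrite (@weight_eq0 _ _ G false) // scale0r.
Qed.

End Bidiff.

Section CountExpo.
Context (S : choiceType) (n : nat) (c : 'I_n -> option S).

Definition count_expo : expo S :=
  [fsfun s in seq_fset tt (pmap c (enum 'I_n)) => #|[set i | c i == Some s]| | 0%N].

Lemma count_expoE s : count_expo s = #|[set i | c i == Some s]|.
Proof.
rewrite fsfunE seq_fsetE; case: ifPn => // ns; apply/esym/eqP.
rewrite cards_eq0; apply/eqP/setP => i; rewrite !inE; apply: contraNF ns => /eqP ci.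
by rewrite mem_pmap -ci map_f // mem_enum.
Qed.

(** Double counting: sums over the support of an exponent, as in the conditions of [Kset], become
    sums over the [n] points. *)
Lemma count_expo_sum (Q : pred S) (wt : S -> nat) :
  (\sum_(s <- finsupp count_expo | Q s) wt s * count_expo s
   = \sum_(i < n) oapp (fun s => if Q s then wt s else 0) 0 (c i))%N.
Proof.
transitivity (\sum_(s <- finsupp count_expo | Q s) \sum_(i < n) wt s * (c i == Some s))%N.
  apply: eq_bigr => s _; rewrite count_expoE -sum1_card big_distrr /= big_mkcond.
  by apply: eq_bigr => i _; rewrite inE; case: (c i == Some s); rewrite ?muln1 ?muln0.
rewrite exchange_big; apply: eq_bigr => i _ /=.
case ci: (c i) => [s|] /=; last by apply: big1 => s _; rewrite muln0.
rewrite big_mkcond (bigD1_seq s) ?fset_uniq //=; last first.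
  rewrite mem_finsupp count_expoE -lt0n card_gt0; apply/set0Pn.
  by exists i; rewrite inE ci.
rewrite eqxx muln1 big1 ?addn0 // => t ts.
have -> : (Some s == Some t) = false by apply/eqP => -[st]; rewrite st eqxx in ts.
by rewrite muln0 if_same.
Qed.

Lemma count_expo_sum1 (Q : pred S) :
  (\sum_(s <- finsupp count_expo | Q s) count_expo s
   = \sum_(i < n) oapp (fun s => if Q s then 1 else 0) 0 (c i))%N.
Proof.
by rewrite -(count_expo_sum _ (fun=> 1%N)); apply: eq_bigr => s _; rewrite mul1n.
Qed.

End CountExpo.

(** * The two sides as sums over local choices *)

Section ProductFormula.
Context (R : realType) (n d a b m : nat) (pi : 'I_d -> 'I_d -> mpoly d R).
Context (p : 'I_a -> mpoly d R) (q : 'I_b -> mpoly d R).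

(** At order [m] the vertices of all chosen graphs number [m] in total, so these graphs suffice, and
    they form a finite type. *)
Definition bounded_graph : finType := {k : 'I_m.+1 & graph k}.

Definition to_graph (g : bounded_graph) : all_graphs :=
  Tagged (fun k => graph k : Type) (tagged g).

Definition gsize (g : bounded_graph) : nat := tag g.

Lemma to_graph_inj : injective to_graph.
Proof.
move=> [k1 G1] [k2 G2] E.
have /val_inj k12 : val k1 = val k2 := congr1 tag E.
subst k2; congr (existT _ _ _); exact: eq_from_Tagged E.
Qed.

Lemma to_graph_onto (G : all_graphs) : (nvert G <= m)%N -> exists g, G = to_graph g.
Proof.
case: G => k G /= km; have km' : (k < m.+1)%N by [].
by exists (existT (fun k : 'I_m.+1 => graph k : Type) (Ordinal km') G).
Qed.

Lemma graph0_proof : @is_graph 0 [ffun => vL 0].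
Proof. by apply/forallP => -[]. Qed.

Definition empty_graph : bounded_graph :=
  existT (fun k : 'I_m.+1 => graph k : Type) ord0 (Sub _ graph0_proof).

Lemma gsize_eq0 g : gsize g = 0%N -> g = empty_graph.
Proof.
case: g => k G; rewrite /gsize /= => k0.
have k00 : k = ord0 by apply: val_inj.
subst k; congr (existT _ _ _); apply/val_inj/ffunP.
by case=> -[].
Qed.

(* The choice, at one point of (R^d)^n, of a factor of e_alpha(p), of a factor
   of e_beta(q) and of a graph; [None] stands for the factor 1. *)
Definition local_choice : finType := (option 'I_a * option 'I_b * bounded_graph)%type.

Definition local_term (y : local_choice) : mpoly d R :=
  (weight R (tagged y.2) / (gsize y.2)`!%:R)
    *: bidiff pi (tagged y.2) (oapp p 1 y.1.1) (oapp q 1 y.1.2).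

Definition local_index : finType := ('I_a.+1 * 'I_b.+1 * bounded_graph)%type.

Definition to_index (s : local_index) : gindex a b := (s.1.1, s.1.2, to_graph s.2).

Lemma to_index_inj : injective to_index.
Proof.
move=> [[l r] g] [[l' r'] g'] E.
have /= [-> ->] := congr1 fst E.
by have /= /to_graph_inj -> := congr1 snd E.
Qed.

Definition index_of_choice (y : local_choice) : option local_index :=
  match y.1.1, y.1.2 with
  | None, None => None
  | l, r => Some (oapp (lift ord0) ord0 l, oapp (lift ord0) ord0 r, y.2)
  end.

(** [index_of_choice] forgets the graph of a point without factors; the empty graph is restored
    here, the only one making that choice valid. *)
Definition choice_of_index (s : option local_index) : local_choice :=
  if s is Some s then (unlift ord0 s.1.1, unlift ord0 s.1.2, s.2)
  else (None, None, empty_graph).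

(** A nonempty graph needs a factor on each side, as in the second condition of [Kset]. The invalid
    choices contribute 0 because 1 is a unit. *)
Definition valid_choice (y : local_choice) : bool :=
  (isSome y.1.1 && isSome y.1.2) || (gsize y.2 == 0%N).

Lemma local_term_invalid y : ~~ valid_choice y -> local_term y = 0.
Proof.
case: y => [[l r] g]; rewrite /valid_choice /local_term /= negb_or.
move=> /andP[lr g0]; have g_gt0 : (0 < gsize g)%N by rewrite lt0n.
rewrite mulrC -scalerA.
case: l lr => [l|] /=; last by rewrite weight_bidiff1l ?scaler0.
case: r => [//|] _; by rewrite weight_bidiff1r ?scaler0.
Qed.

Lemma local_term_valid y : valid_choice y ->
  local_term y = oapp (Bfamily pi p q \o to_index) 1 (index_of_choice y).
Proof.
case: y => [[l r] g]; rewrite /valid_choice /local_term /index_of_choice /=.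
case: l => [l|]; case: r => [r|] /=; rewrite /Bfamily /=.
- by rewrite !liftK.
- move=> /eqP/gsize_eq0 ->; rewrite liftK unlift_none /=.
  by rewrite bidiff0 weight_graph0 fact0 divr1 scale1r mulr1.
- move=> /eqP/gsize_eq0 ->; rewrite liftK unlift_none /=.
  by rewrite bidiff0 weight_graph0 fact0 divr1 scale1r mul1r.
- move=> /eqP/gsize_eq0 ->.
  by rewrite bidiff0 weight_graph0 fact0 divr1 scale1r mulr1.
Qed.

Lemma index_of_choiceK y : valid_choice y -> choice_of_index (index_of_choice y) = y.
Proof.
case: y => [[l r] g]; rewrite /valid_choice /index_of_choice /choice_of_index /=.
case: l => [l|]; case: r => [r|] /=; rewrite ?liftK ?unlift_none //.
by move=> /eqP/gsize_eq0 ->.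
Qed.

Lemma choice_of_indexK s : (forall g, s != Some (ord0, ord0, g)) ->
  index_of_choice (choice_of_index s) = s.
Proof.
case: s => [[[l r] g]|] //= /(_ g); rewrite /index_of_choice /=.
case: unliftP => [l' ->|->]; case: unliftP => [r' ->|->] //=.
by rewrite eqxx.
Qed.

Definition choice_pred (alpha : expo 'I_a) (beta : expo 'I_b)
    (D : {ffun 'I_n -> local_choice}) : bool :=
  [&& [forall l, #|[set i | (D i).1.1 == Some l]| == alpha l],
      [forall r, #|[set i | (D i).1.2 == Some r]| == beta r]
    & (\sum_i gsize (D i).2)%N == m].

Lemma star_multisymE (alpha : expo 'I_a) (beta : expo 'I_b) :
  (0 < n)%N -> (0 < d)%N ->
  star (product_pi pi) (hconst (multisym n p alpha)) (hconst (multisym n q beta)) m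
  = \sum_(D | choice_pred alpha beta D) \prod_i at_point i (local_term (D i)).
Proof.
move=> n0 d0; rewrite star_hconst.
rewrite (@multisymE R n d _ _ id p alpha (@inj_id _) (fun x _ => ex_intro _ x erefl)).
rewrite (@multisymE R n d _ _ id q beta (@inj_id _) (fun x _ => ex_intro _ x erefl)).
rewrite star_coef_sum.
pose mk (x : {ffun 'I_n -> option 'I_a} * {ffun 'I_n -> option 'I_b} *
             {ffun 'I_n -> bounded_graph}) : {ffun 'I_n -> local_choice} :=
  [ffun i => (x.1.1 i, x.1.2 i, x.2 i)].
pose unmk (D : {ffun 'I_n -> local_choice}) := ([ffun i => (D i).1.1],
  [ffun i => (D i).1.2], [ffun i => (D i).2]) :
  {ffun 'I_n -> option 'I_a} * {ffun 'I_n -> option 'I_b} * {ffun 'I_n -> bounded_graph}.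
rewrite [RHS](reindex mk) /=; last first.
  exists unmk; first move=> [[x y] z] _ /=.
    by congr (_, _, _); apply/ffunP => i; rewrite !ffunE.
  by move=> D _; apply/ffunP => i; rewrite !ffunE -!surjective_pairing.
pose Pa (x : {ffun 'I_n -> option 'I_a}) := [forall l, color_count x l == alpha l].
pose Pb (y : {ffun 'I_n -> option 'I_b}) := [forall r, color_count y r == beta r].
pose Pm (z : {ffun 'I_n -> bounded_graph}) := (\sum_i gsize (z i))%N == m.
rewrite (eq_bigl (fun x => Pa x.1.1 && Pb x.1.2 && Pm x.2)); last first.
  move=> [[x y] z]; rewrite /choice_pred andbA /=; congr (_ && _ && _).
  - apply: eq_forallb => l; congr (_ == _); apply: eq_card => i.
    by rewrite !inE ffunE.
  - apply: eq_forallb => r; congr (_ == _); apply: eq_card => i.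
    by rewrite !inE ffunE.
  - by congr (_ == _); apply: eq_bigr => i _; rewrite ffunE.
rewrite -(pair_big (fun u : _ * _ => Pa u.1 && Pb u.2) Pm
  (fun u z => \prod_i at_point i (local_term (mk (u, z) i)))) /=.
rewrite -(pair_big Pa Pb
  (fun x y => \sum_(z | Pm z) \prod_i at_point i (local_term (mk (x, y, z) i)))) /=.
apply: eq_bigr => x _; apply: eq_bigr => y _.
rewrite (@star_coef_prod R n d m pi (fun i => oapp p 1 (x i)) (fun i => oapp q 1 (y i))
  (@weight_glue R) (@weight_graph0 R) n0 d0).
pose T i g := at_point i (local_term (x i, y i, g)).
(* With the local series written as a sum of monomials over graphs, distributing the product assigns
   a graph to each point, and the coefficient of degree [m] selects the assignments of total size
   [m]. *)
have polyE i : \poly_(j < m.+1)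
      at_point i (star_coef pi j (oapp p 1 (x i)) (oapp q 1 (y i)))
    = \sum_(g : bounded_graph) (T i g)%:P * 'X^(gsize g).
  pose F (j : 'I_m.+1) (G : graph j) : {poly mpoly (ncoord n d) R} :=
    (at_point i ((weight R G / j`!%:R)
       *: bidiff pi G (oapp p 1 (x i)) (oapp q 1 (y i))))%:P * 'X^j.
  rewrite poly_def; transitivity (\sum_(j < m.+1) \sum_(G : graph j) F j G).
    apply: eq_bigr => j _; rewrite /star_coef at_point_sum scaler_suml.
    by apply: eq_bigr => G _; rewrite /F mul_polyC.
  exact: (sig_big_dep xpredT (fun _ => xpredT) F).
under eq_bigr do rewrite polyE.
rewrite bigA_distr_bigA coef_sum [RHS]big_mkcond /=; apply: eq_bigr => z _.
rewrite big_split /= -rmorph_prod -expr_sum mulrC coefXnM coefC.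
rewrite /Pm; set N := (\sum_i _)%N; have [Nm|Nm] := eqVneq N m.
  by rewrite Nm ltnn subnn eqxx; apply: eq_bigr => i _; rewrite /T ffunE.
by case: ltnP => // mN; rewrite ifN // subn_eq0 -ltnNge ltn_neqAle Nm mN.
Qed.

Lemma sum_gsize_index (D : {ffun 'I_n -> local_choice}) :
  (forall i, valid_choice (D i)) ->
  (\sum_i oapp (fun s : gindex a b => nvert s.2) 0
     (omap to_index (index_of_choice (D i))) = \sum_i gsize (D i).2)%N.
Proof.
move=> vD; apply: eq_bigr => i _; have := vD i.
case: (D i) => [[[l|] [r|]] g] //=.
by rewrite /valid_choice /= => /eqP ->.
Qed.

Lemma Kset_choice (alpha : expo 'I_a) (beta : expo 'I_b)
    (D : {ffun 'I_n -> local_choice}) : (forall i, valid_choice (D i)) ->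
  Kset n m alpha beta
    (count_expo (fun i => omap to_index (index_of_choice (D i))))
  <-> choice_pred alpha beta D.
Proof.
move=> vD; set c := fun i => _; set gamma := count_expo c.
have rowE l : (\sum_(s <- finsupp gamma | s.1.1 == lift ord0 l) gamma s)%N
    = #|[set i | (D i).1.1 == Some l]|.
  rewrite count_expo_sum1 -sum1_card [RHS]big_mkcond; apply: eq_bigr => i _.
  by rewrite inE /c /index_of_choice; case: (D i) => [[[l'|] [r'|]] g].
have colE r : (\sum_(s <- finsupp gamma | s.1.2 == lift ord0 r) gamma s)%N
    = #|[set i | (D i).1.2 == Some r]|.
  rewrite count_expo_sum1 -sum1_card [RHS]big_mkcond; apply: eq_bigr => i _.
  by rewrite inE /c /index_of_choice; case: (D i) => [[[l'|] [r'|]] g].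
have sizeE : (\sum_(s <- finsupp gamma) nvert s.2 * gamma s)%N
    = (\sum_i gsize (D i).2)%N.
  by rewrite (count_expo_sum c xpredT (fun s => nvert s.2)) -sum_gsize_index.
rewrite /Kset /choice_pred /= sizeE; split.
  move=> [[_ _ _ sz] [rows cols]]; apply/and3P; split; last exact/eqP.
    by apply/forallP => l; rewrite -rowE rows.
  by apply/forallP => r; rewrite -colE cols.
case/and3P => /forallP rows /forallP cols /eqP sz; split; split => //.
- move=> G; rewrite count_expoE; apply/eqP; rewrite cards_eq0; apply/eqP/setP => i.
  rewrite !inE /c /index_of_choice.
  by case: (D i) => [[[l'|] [r'|]] g] //=; apply/eqP => -[].
- move=> l r G lr G1; rewrite count_expoE; apply/eqP; rewrite cards_eq0.
  apply/eqP/setP => i; rewrite !inE; apply/negP => /eqP.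
  have := vD i; rewrite /c /index_of_choice /valid_choice.
  case: (D i) => [[[l'|] [r'|]] g] //= => [_|/eqP g0|/eqP g0] E.
  + have := congr1 (oapp (fun s : gindex a b => s.1) (ord0, ord0)) E.
    by move=> /= [El Er]; case: lr => lr; move: El Er; rewrite lr.
  + have G0 : gsize g = nvert G := congr1 (oapp (fun s : gindex a b => nvert s.2) 0%N) E.
    by rewrite -G0 g0 in G1.
  + have G0 : gsize g = nvert G := congr1 (oapp (fun s : gindex a b => nvert s.2) 0%N) E.
    by rewrite -G0 g0 in G1.
- have -> : (\sum_(s <- finsupp gamma) gamma s
      = \sum_(s <- finsupp gamma | xpredT s) gamma s)%N by [].
  rewrite count_expo_sum1 -[leqRHS]card_ord -sum1_card; apply: leq_sum => i _.
  by case: (c i).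
- by move=> l; rewrite rowE; apply/eqP.
- by move=> r; rewrite colE; apply/eqP.
Qed.

(** With exactly one factor, the graph is empty by the second condition of [Kset]. With none, the
    exponent does not see the graph, and the round trip forces it to be empty. *)
Lemma Kset_valid (alpha : expo 'I_a) (beta : expo 'I_b)
    (D : {ffun 'I_n -> local_choice}) :
  Kset n m alpha beta
    (count_expo (fun i => omap to_index (index_of_choice (D i)))) ->
  (forall i, choice_of_index (index_of_choice (D i)) = D i) ->
  forall i, valid_choice (D i).
Proof.
move=> [[_ K2 _ _] _] DK i; have := DK i.
have K2i s : omap to_index (index_of_choice (D i)) = Some s ->
    s.1.1 = ord0 \/ s.1.2 = ord0 -> nvert s.2 = 0%N.
  case: s => [[l r] G] /= Ds lr; apply/eqP; rewrite -leqn0 leqNgt; apply/negP => G1.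
  have := K2 l r G lr G1; rewrite count_expoE => /eqP; rewrite cards_eq0.
  move=> /eqP/setP/(_ i).
  by rewrite !inE Ds eqxx.
move: K2i; rewrite /valid_choice.
case: (D i) => [[[l'|] [r'|]] g] //= K2i.
- by move=> _; apply/eqP; exact: (K2i _ erefl (or_intror erefl)).
- by move=> _; apply/eqP; exact: (K2i _ erefl (or_introl erefl)).
- by case=> <-.
Qed.

Lemma sum_KsetE (alpha : expo 'I_a) (beta : expo 'I_b) (u : gindex a b -> mpoly d R) :
  \sum_(gamma \in Kset n m alpha beta) multisym n u gamma
  = \sum_(C : {ffun 'I_n -> option local_index} |
          `[< Kset n m alpha beta (count_expo (fun i => omap to_index (C i))) >])
      \prod_i at_point i (oapp (u \o to_index) 1 (C i)).
Proof.
pose gc (C : {ffun 'I_n -> option local_index}) :=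
  count_expo (fun i => omap to_index (C i)).
pose F (C : {ffun 'I_n -> option local_index}) :=
  \prod_i at_point i (oapp (u \o to_index) 1 (C i)).
have multisymK gamma : Kset n m alpha beta gamma ->
    multisym n u gamma = \sum_(C | gc C == gamma) F C.
  move=> [[_ _ _ sz] _].
  (* An index used at least once contributes its graph size to the total [m], so that graph is
     bounded. *)
  have onto s : s \in finsupp gamma -> exists s', s = to_index s'.
    move=> sg; have sm : (nvert s.2 <= m)%N.
      rewrite -sz (big_rem s) //= (leq_trans _ (leq_addr _ _)) // leq_pmulr //.
      by rewrite lt0n -mem_finsupp.
    have [g gE] := to_graph_onto sm; exists (s.1.1, s.1.2, g).
    by rewrite /to_index /= -gE -!surjective_pairing.
  rewrite (multisymE _ _ to_index_inj onto); apply: eq_bigl => C.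
  have cE s' : color_count C s' = gc C (to_index s').
    rewrite count_expoE; apply: eq_card => i; rewrite !inE.
    case: (C i) => [t|]; last by [].
    exact: esym (inj_eq to_index_inj t s').
  apply/forallP/eqP => [CE|<- s']; last by rewrite cE.
  apply/fsfunP => s; have [/onto[s' ->]|sg] := boolP (s \in finsupp gamma).
    by rewrite -cE; apply/eqP.
  rewrite (fsfun_dflt sg) count_expoE; apply/eqP; rewrite cards_eq0.
  apply/eqP/setP => i; rewrite !inE; apply/negP => /eqP.
  case Ci: (C i) => [s'|] //= [ss'].
  have := CE s'; rewrite ss' (fsfun_dflt sg) /color_count cards_eq0 => /eqP/setP/(_ i).
  by rewrite !inE Ci eqxx.
(* Only exponents realized by a colouring are listed; for any other element of [Kset], the expansion
   of [multisym] is an empty sum. *)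
pose r := [seq gamma <- undup [seq gc C | C <- enum {ffun 'I_n -> option local_index}]
           | `[< Kset n m alpha beta gamma >]].
have memr C : (gc C \in r) = `[< Kset n m alpha beta (gc C) >].
  by rewrite mem_filter mem_undup map_f ?mem_enum // andbT.
rewrite (fsbigE r).
- transitivity (\sum_(gamma <- r) \sum_C if gc C == gamma then F C else 0).
    rewrite big_seq_cond [RHS]big_seq; apply: eq_big => [gamma|gamma].
      case gr: (gamma \in r) => //=; apply: mem_set.
      by move: gr; rewrite mem_filter => /andP[/asboolP].
    by move=> /andP[_ /set_mem Kg]; rewrite multisymK // big_mkcond.
  rewrite exchange_big [RHS]big_mkcond; apply: eq_bigr => C _ /=.
  rewrite -/(gc C) -memr; case: ifPn => Cr; last first.
    rewrite big_seq big1 // => gamma gr; case: eqP => // E.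
    by rewrite E gr in Cr.
  rewrite (bigD1_seq (gc C)) //= ?filter_uniq ?undup_uniq // eqxx.
  by rewrite big1 ?addr0 // => gamma; rewrite eq_sym => /negbTE ->.
- by rewrite filter_uniq // undup_uniq.
- by move=> gamma /=; rewrite mem_filter => /andP[/asboolP].
- move=> gamma Kg gr; rewrite multisymK // big1 // => C /eqP CE.
  by move: gr; rewrite -CE memr CE => /asboolP; case.
Qed.

Lemma sum_Kset_choice (alpha : expo 'I_a) (beta : expo 'I_b) :
  \sum_(gamma \in Kset n m alpha beta) multisym n (Bfamily pi p q) gamma
  = \sum_(D | choice_pred alpha beta D) \prod_i at_point i (local_term (D i)).
Proof.
rewrite sum_KsetE.
pose h (D : {ffun 'I_n -> local_choice}) : {ffun 'I_n -> option local_index} :=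
  [ffun i => index_of_choice (D i)].
pose h' (C : {ffun 'I_n -> option local_index}) : {ffun 'I_n -> local_choice} :=
  [ffun i => choice_of_index (C i)].
have hE D : count_expo (fun i => omap to_index (h D i))
    = count_expo (fun i => omap to_index (index_of_choice (D i))).
  by congr count_expo; apply/funext => i; rewrite ffunE.
rewrite (reindex_onto h h') => [|C /asboolP[[K1 _ _ _] _]]; last first.
  apply/ffunP => i; rewrite !ffunE choice_of_indexK // => g; apply/eqP => Ci.
  have := K1 (to_graph g); rewrite count_expoE => /eqP.
  by rewrite cards_eq0 => /eqP/setP/(_ i); rewrite !inE Ci /= eqxx.
(* Only families of valid choices correspond to index colourings; any other family has a zero factor
   at some point. *)
rewrite [RHS](bigID (fun D : {ffun 'I_n -> local_choice} =>
  [forall i, valid_choice (D i)])) /=.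
rewrite [X in _ + X]big1 ?addr0 => [|D /andP[_ /forallPn[i /local_term_invalid Di]]].
  apply: eq_big => [D|D /andP[/asboolP KD /eqP DK]].
    apply/andP/andP => -[].
      rewrite hE => /asboolP KD /eqP/ffunP DK.
      have vD : forall i, valid_choice (D i).
        by apply: (Kset_valid KD) => i; have := DK i; rewrite !ffunE.
      by split; [exact/(Kset_choice _ _ vD)|exact/forallP].
    move=> cD /forallP vD; split; first by apply/asboolP; rewrite hE; exact/Kset_choice.
    by apply/eqP/ffunP => i; rewrite !ffunE index_of_choiceK.
  have vD : forall i, valid_choice (D i).
    rewrite hE in KD; apply: (Kset_valid KD) => i.
    by move/ffunP/(_ i): DK; rewrite !ffunE.
  by apply: eq_bigr => i _; rewrite ffunE local_term_valid.
by rewrite (bigD1 i) //= Di at_point0 mul0r.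
Qed.

End ProductFormula.

Local Open Scope classical_set_scope.

Theorem theorem23 (R : realType) (d a b n : nat)
    (hd : (0 < d)%N) (ha : (0 < a)%N) (hb : (0 < b)%N) (hn : (0 < n)%N)
    (P : regular_poisson R d)
    (p : 'I_a -> mpoly d R) (q : 'I_b -> mpoly d R)
    (alpha : {fsfun 'I_a -> nat with 0%N}) (beta : {fsfun 'I_b -> nat with 0%N})
    (halpha : (\sum_(l < a) alpha l <= n)%N)
    (hbeta : (\sum_(r < b) beta r <= n)%N) :
  let pi := poisson_pi P in
  let ealpha := hconst (multisym n p alpha) in
  let ebeta := hconst (multisym n q beta) in
  [/\ @quantum_symmetric R n d ealpha,
      @quantum_symmetric R n d ebeta
    & star (product_pi pi) ealpha ebeta =
      (fun m : nat => \sum_(gamma \in Kset n m alpha beta)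
         multisym n (Bfamily pi p q) gamma)].
Proof.
move=> pi ealpha ebeta; split.
- by apply: quantum_symmetric_hconst => s; exact: perm_points_multisym.
- by apply: quantum_symmetric_hconst => s; exact: perm_points_multisym.
- by apply/funext => m; rewrite star_multisymE // sum_Kset_choice.
Qed.
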